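(* Let $G$ be a discrete group acting by holomorphic diffeomorphisms on a complex manifold $X$. Every $G$-equivariant hermitian (holomorphic) gerbe on $X$ possesses a unique compatible connective structure.
   Context: Let $\mathcal U=(V_a)_{a\in I}$ be an open covering of $X$ with $G$ acting on $I$ so that $gV_a=V_{ga}$. A $G$-equivariant holomorphic gerbe (with respect to $\mathcal U$) consists of holomorphic line bundles $L_{a,b}$ on $V_a\cap V_b$ ($L_{a,a}$ trivial, $L_{b,a}=L_{a,b}^{-1}$), holomorphic line bundles $L_a(g)$ on $V_a$ for $g\in G$, and holomorphic isomorphisms $\phi_{a,b,c}:L_{a,c}\to L_{a,b}\otimes L_{b,c}$ on $V_a\cap V_b\cap V_c$, $\phi_{a,b}(g):(g^{-1})^*L_{g^{-1}a,g^{-1}b}\otimes L_b(g)\to L_a(g)\otimes L_{a,b}$ on $V_a\cap V_b$, $\phi_a(g,h):L_a(gh)\to L_a(g)\otimes(g^{-1})^*L_{g^{-1}a}(h)$ on $V_a$, where $\phi_{a,b,c}$ is skew-symmetric in $a,b,c$ as an invertible section of $L_{a,b}\otimes L_{b,c}\otimes L_{c,a}$, is coassociative, $(\phi_{a,b,c}\otimes\mathrm{id})\circ\phi_{a,c,d}=(\mathrm{id}\otimes\phi_{b,c,d})\circ\phi_{a,b,d}$ on fourfold intersections, and the remaining natural coherence conditions hold (in local trivializations of the bundles, all conditions say that the functions $\phi_{a,b,c},\phi_{a,b}(g),\phi_a(g,h)$ form a 2-cocycle in the total complex of $C^p(G,\check C^q(\mathcal U,\mathcal O^\times))$). An equivariant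 hermitian structure is a collection of (smooth) hermitian metrics on all $L_{a,b}$ and all $L_a(g)$ such that all the isomorphisms $\phi_{a,b,c}$, $\phi_{a,b}(g)$, $\phi_a(g,h)$ are unitary. An equivariant hermitian gerbe is an equivariant holomorphic gerbe with an equivariant hermitian structure. A connective structure on the equivariant gerbe is a collection of smooth complex connections $\nabla_{a,b}$ on $L_{a,b}$ and $\nabla_{a;g}$ on $L_a(g)$ compatible with the structure maps, i.e. $\phi_{a,b,c}\circ\nabla_{a,c}=(\nabla_{a,b}\otimes\mathrm{id}+\mathrm{id}\otimes\nabla_{b,c})\circ\phi_{a,b,c}$, and analogously $\phi_{a,b}(g)$ and $\phi_a(g,h)$ intertwine the induced tensor product and pull-back connections. A compatible connective structure on an equivariant hermitian gerbe is a connective structure whose connections $\nabla_{a,b},\nabla_{a;g}$ preserve the hermitian structures and are compatible with the holomorphic structures (their $(0,1)$-parts are the $\bar\partial$-operators). *)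

(* Defs.v *)
From HB Require Import structures.
From mathcomp Require Import all_boot all_order all_algebra.
From mathcomp Require Import all_classical all_reals all_analysis.
From mathcomp Require Import complex.

Set Implicit Arguments.
Unset Strict Implicit.
Unset Printing Implicit Defensive.

Import Order.TTheory GRing.Theory Num.Theory.
Import numFieldNormedType.Exports.

Local Open Scope classical_set_scope.
Local Open Scope ring_scope.

(** C^m as R^m + i R^m, so as to have its structure of normed R-space. *)
Notation cspace R m := ('rV[R]_m * 'rV[R]_m)%type.

Section Calculus.
Variable R : realType.

Definition imul m (v : cspace R m) : cspace R m := (- v.2, v.1).

(** C^(k+1) : Fréchet differentiable, with all directional derivatives C^k.
    [U] is
    always an open set. *)
Fixpoint Ck (k : nat) m (U : set (cspace R m)) (f : cspace R m -> R) : Prop :=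
  match k with
  | 0 => forall z, U z -> {for z, continuous f}
  | k'.+1 => (forall z, U z -> differentiable (f : _ -> R^o) z) /\
             forall v, Ck k' U (fun z => 'd (f : _ -> R^o) z v)
  end.

Definition csmooth m (U : set (cspace R m)) (f : cspace R m -> R[i]) : Prop :=
  forall k, Ck k U (fun z => complex.Re (f z)) /\
            Ck k U (fun z => complex.Im (f z)).

Definition cdiff m (f : cspace R m -> R[i]) (z v : cspace R m) : R[i] :=
  Complex ('d ((fun z => complex.Re (f z)) : _ -> R^o) z v)
          ('d ((fun z => complex.Im (f z)) : _ -> R^o) z v).

(** Smooth, with C-linear differential (Cauchy-Riemann). *)
Definition cholo m (U : set (cspace R m)) (f : cspace R m -> R[i]) : Prop :=
  csmooth U f /\
  forall z v, U z -> cdiff f z (imul v) = 'i * cdiff f z v.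

Definition cholo_map m k (U : set (cspace R m)) (F : cspace R m -> cspace R k) :=
  forall j : 'I_k, cholo U (fun z => Complex ((F z).1 ord0 j) ((F z).2 ord0 j)).

End Calculus.

(** The dimension is only locally constant.  [chart_at] is a choice of a chart
    around each point; it serves to write down tangent vectors. *)
Record complex_manifold (R : realType) := ComplexManifold {
  cm_space :> topologicalType;
  cm_hausdorff : hausdorff_space cm_space;
  cm_second_countable : @second_countable cm_space;
  chart : Type;
  cdim : chart -> nat;
  cdom : chart -> set cm_space;
  cmap : forall c, cm_space -> cspace R (cdim c);
  cinv : forall c, cspace R (cdim c) -> cm_space;
  chart_at : cm_space -> chart;
  open_cdom : forall c, open (cdom c);
  open_cimg : forall c, open (cmap c @` cdom c);
  cmapK : forall c x, cdom c x -> @cinv c (cmap c x) = x;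
  continuous_cmap : forall c x, cdom c x -> {for x, continuous (cmap c)};
  continuous_cinv : forall c z, (cmap c @` cdom c) z ->
    {for z, continuous (@cinv c)};
  chart_atP : forall x, cdom (chart_at x) x;
  holo_transition : forall c d,
    cholo_map (cmap c @` (cdom c `&` cdom d)) (cmap d \o @cinv c)
}.

Arguments chart {R} X : rename.
Arguments cdim {R X} c : rename.
Arguments cdom {R X} c _ : rename.
Arguments cmap {R X} c x : rename.
Arguments cinv {R X} c z : rename.
Arguments chart_at {R X} x : rename.

Section Manifold.
Variables (R : realType) (X : complex_manifold R).
Local Notation C := R[i].

(** [tangent x] is T_x X read in the chart [chart_at x]. *)
Definition tangent (x : X) : Type := cspace R (cdim (chart_at x)).

Definition smooth_on (U : set X) (f : X -> C) : Prop :=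
  forall c : chart X, csmooth (cmap c @` (U `&` cdom c)) (f \o cinv c).

Definition holo_on (U : set X) (f : X -> C) : Prop :=
  forall c : chart X, cholo (cmap c @` (U `&` cdom c)) (f \o cinv c).

Definition mdiff (f : X -> C) (x : X) (v : tangent x) : C :=
  cdiff (f \o cinv (chart_at x)) (cmap (chart_at x) x) v.

Definition mdbar (f : X -> C) (x : X) (v : tangent x) : C :=
  2^-1 * (mdiff f v + 'i * mdiff f (imul v)).

Definition map_diff (F : X -> X) (x : X) (v : tangent x) : tangent (F x) :=
  'd (cmap (chart_at (F x)) \o F \o cinv (chart_at x) :
        cspace R (cdim (chart_at x)) -> cspace R (cdim (chart_at (F x))))
    (cmap (chart_at x) x) v.

(** The vector field on [cdom c] which is constant equal to [v] in [c]. *)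
Definition coord_field (c : chart X) (v : cspace R (cdim c)) (x : X) :
  tangent x :=
  'd (cmap (chart_at x) \o cinv c :
        cspace R (cdim c) -> cspace R (cdim (chart_at x))) (cmap c x) v.

Definition holo_selfmap (F : X -> X) : Prop :=
  continuous F /\
  forall c d : chart X,
    cholo_map (cmap c @` (cdom c `&` F @^-1` cdom d)) (cmap d \o F \o cinv c).

End Manifold.

Arguments mdiff {R X} f x v.
Arguments mdbar {R X} f x v.
Arguments map_diff {R X} F x v.

(** [tens A B] is A ⊗ B written in the bases [vbasis]; [tliftE] and
    [tens_ext] are its universal property. *)
Section Tensor.
Variable K : fieldType.
Implicit Types A B D : vectType K.

Definition tens A B : vectType K := 'M[K]_(\dim {:A}, \dim {:B}).

Definition pure A B (a : A) (b : B) : tens A B :=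
  \matrix_(i, j) (coord (vbasis {:A}) i a * coord (vbasis {:B}) j b).

Definition tlift A B D (f : A -> B -> D) (t : tens A B) : D :=
  \sum_i \sum_j t i j *: f (vbasis {:A})`_i (vbasis {:B})`_j.

Definition tmap A B A' B' (f : A -> A') (g : B -> B') : tens A B -> tens A' B' :=
  tlift (fun a b => pure (f a) (g b)).

Definition tswap A B : tens A B -> tens B A := tlift (fun a b => pure b a).

Definition tassoc A B D : tens (tens A B) D -> tens A (tens B D) :=
  tlift (fun t d => tlift (fun a b => pure a (pure b d)) t).

Definition tassocV A B D : tens A (tens B D) -> tens (tens A B) D :=
  tlift (fun a t => tlift (fun b d => pure (pure a b) d) t).

Lemma tliftE A B D (f : A -> B -> D)
    (fl : forall b, linear (f^~ b)) (fr : forall a, linear (f a)) a b :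
  tlift f (pure a b) = f a b.
Proof.
have fl_sum n (c : 'I_n -> K) (e : 'I_n -> A) b' :
    f (\sum_i c i *: e i) b' = \sum_i c i *: f (e i) b'.
  pose L := GRing.isLinear.Build _ _ _ _ (f^~ b') (fl b').
  pose F : {linear A -> D} := HB.pack (f^~ b') L.
  by rewrite -[LHS]/(F _) linear_sum; apply: eq_bigr => i _; rewrite linearZ.
have fr_sum n (c : 'I_n -> K) (e : 'I_n -> B) a' :
    f a' (\sum_i c i *: e i) = \sum_i c i *: f a' (e i).
  pose L := GRing.isLinear.Build _ _ _ _ (f a') (fr a').
  pose F : {linear B -> D} := HB.pack (f a') L.
  by rewrite -[LHS]/(F _) linear_sum; apply: eq_bigr => i _; rewrite linearZ.
rewrite [in RHS](coord_vbasis (memvf a)) [in RHS](coord_vbasis (memvf b)).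
rewrite fl_sum; apply: eq_bigr => i _.
rewrite fr_sum scaler_sumr; apply: eq_bigr => j _.
by rewrite mxE scalerA.
Qed.

Lemma tens_ext A B D (f g : tens A B -> D) : linear f -> linear g ->
  (forall a b, f (pure a b) = g (pure a b)) -> f =1 g.
Proof.
move=> fl gl fg t.
pose F : {linear tens A B -> D} := HB.pack f (GRing.isLinear.Build _ _ _ _ f fl).
pose G : {linear tens A B -> D} := HB.pack g (GRing.isLinear.Build _ _ _ _ g gl).
rewrite -[LHS]/(F t) -[RHS]/(G t) [t]matrix_sum_delta !linear_sum.
apply: eq_bigr => i _; rewrite !linear_sum; apply: eq_bigr => j _.
rewrite !linearZ; congr (_ *: _).
have -> : delta_mx i j = pure (vbasis {:A})`_i (vbasis {:B})`_j.
  apply/matrixP => k l; rewrite !mxE !coord_free ?(basis_free (vbasisP _)) //.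
  by rewrite -natrM mulnb eq_sym [l == j]eq_sym.
exact: fg.
Qed.

End Tensor.

(** The underlying data of a holomorphic vector bundle of rank 1 over a subset
    of [X]: fibres and, for each point [x], a frame around [x].  The fibres
    outside of the base are irrelevant, as are the frames outside of their
    domains. *)
Record bundle (R : realType) (X : complex_manifold R) := Bundle {
  fibre :> X -> vectType R[i];
  fdom : X -> set X;
  frame : X -> forall y, fibre y
}.

Section Bundles.
Variables (R : realType) (X : complex_manifold R).
Local Notation C := R[i].
Implicit Types (L M N : bundle X) (U W : set X).

Record is_line_bundle W L : Prop := IsLineBundle {
  base_open : open W;
  fibre_dim1 : forall x, W x -> \dim {:L x} = 1%N;
  fdom_self : forall x, W x -> fdom L x x;
  fdom_open : forall x, open (fdom L x);
  fdom_sub : forall x, fdom L x `<=` W;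
  frame_neq0 : forall x y, fdom L x y -> frame L x y != 0;
  frame_transition : forall x y, exists h : X -> C,
    holo_on (fdom L x `&` fdom L y) h /\
    forall z, (fdom L x `&` fdom L y) z -> frame L y z = h z *: frame L x z
}.

Definition section L := forall x, L x.

Definition line_coord (A : vectType C) (e v : A) : C :=
  coord [tuple e] ord0 v.

Definition smooth_section L U (s : section L) : Prop :=
  forall y, exists f : X -> C, smooth_on (U `&` fdom L y) f /\
    forall z, (U `&` fdom L y) z -> s z = f z *: frame L y z.

Definition holo_section L U (s : section L) : Prop :=
  forall y, exists f : X -> C, holo_on (U `&` fdom L y) f /\
    forall z, (U `&` fdom L y) z -> s z = f z *: frame L y z.

Definition smooth_section_near L W (x : X) (s : section L) : Prop :=
  exists U, [/\ open U, U x, U `<=` W & smooth_section U s].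

Definition trivial_bundle W : bundle X :=
  @Bundle R X (fun=> C^o) (fun=> W) (fun _ _ => 1).

Definition dual_bundle L : bundle X :=
  @Bundle R X (fun x => 'Hom(L x, C^o)) (fdom L)
    (fun x y => linfun (line_coord (frame L x y) : L y -> C^o)).

Definition tensor_bundle L M : bundle X :=
  @Bundle R X (fun x => tens (L x) (M x)) (fun x => fdom L x `&` fdom M x)
    (fun x y => pure (frame L x y) (frame M x y)).

Definition pullback_bundle (F : X -> X) L : bundle X :=
  @Bundle R X (fun x => L (F x)) (fun x => F @^-1` fdom L (F x))
    (fun x y => frame L (F x) (F y)).

Definition bundle_map L M := forall x, 'Hom(L x, M x).

Definition holo_iso W L M (phi : bundle_map L M) : Prop :=
  (forall x, W x -> bijective (phi x)) /\
  forall U (s : section L), open U -> U `<=` W -> holo_section U s ->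
    holo_section U (fun x => phi x (s x) : M x).

(** Metrics are C-linear in the first variable. *)
Definition metric L := forall x, L x -> L x -> C.

Definition is_metric W L (h : metric L) : Prop :=
  [/\ forall x (k : C) (u u' w : L x), W x ->
        h x (k *: u + u') w = k * h x u w + h x u' w,
      forall x (u w : L x), W x -> h x u w = (h x w u)^*,
      forall x (u : L x), W x -> u != 0 -> 0 < h x u u &
      forall U (s t : section L), open U -> U `<=` W ->
        smooth_section U s -> smooth_section U t ->
        smooth_on U (fun x => h x (s x) (t x))].

(** The metric with <a ⊗ b, a' ⊗ b'> = <a, a'> <b, b'>, extended linearly
    in the first and antilinearly in the second variable. *)
Definition tensor_metric L M (h : metric L) (k : metric M) :
  metric (tensor_bundle L M) :=
  fun x t t' => tlift (D := C^o) (fun a b =>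
    (tlift (D := C^o) (fun a' b' => (h x a a' * k x b b')^*) t')^*) t.

Definition pullback_metric (F : X -> X) L (h : metric L) :
  metric (pullback_bundle F L) := fun x => h (F x).

Definition unitary W L M (h : metric L) (k : metric M) (phi : bundle_map L M) :=
  forall x (u w : L x), W x -> k x (phi x u) (phi x w) = h x u w.

(** [D s x v] is the covariant derivative at [x] of the section [s], smooth
    near [x], in the direction of [v].  It is irrelevant when [s] is not smooth
    near [x] or [x] is not in the base. *)
Definition connection L := section L -> forall x, tangent x -> L x.

Definition is_connection W L (D : connection L) : Prop :=
  [/\ forall x v (s t : section L), W x ->
        smooth_section_near W x s -> smooth_section_near W x t ->
        (\forall y \near x, s y = t y) -> D s x v = D t x v,
      forall x v (s t : section L), W x ->
        smooth_section_near W x s -> smooth_section_near W x t ->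
        D (fun y => s y + t y) x v = D s x v + D t x v,
      forall x v (s : section L) (f : X -> C) U, W x ->
        smooth_section_near W x s -> open U -> U x -> smooth_on U f ->
        D (fun y => f y *: s y) x v = mdiff f x v *: s x + f x *: D s x v,
      forall x (a : R) (v w : cspace R (cdim (chart_at x))) (s : section L),
        W x -> smooth_section_near W x s ->
        D s x (a *: v + w) = a%:C%C *: D s x v + D s x w &
      forall U (c : chart X) (v : cspace R (cdim c)) (s : section L),
        open U -> U `<=` W -> smooth_section U s ->
        smooth_section (U `&` cdom c) (fun x => D s x (coord_field v x) : L x)].

(** nabla ⊗ id + id ⊗ nabla': if [t = u (e ⊗ f)] with [e], [f] the frames
    around [x], its derivative is
    [du (e ⊗ f) + u (nabla e ⊗ f + e ⊗ nabla' f)]. *)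
Definition tensor_connection L M (D : connection L) (D' : connection M) :
  connection (tensor_bundle L M) :=
  fun t x v =>
    let e := frame L x in
    let f := frame M x in
    let u := fun y => line_coord (pure (e y) (f y)) (t y) in
    mdiff u x v *: pure (e x) (f x) +
    u x *: (pure (D e x v) (f x) + pure (e x) (D' f x v)).

(** If [t = u F^*e] with [e] the frame of [L] around [F x], its derivative is
    [du F^*e + u F^*(nabla e)]. *)
Definition pullback_connection (F : X -> X) L (D : connection L) :
  connection (pullback_bundle F L) :=
  fun t x v =>
    let e := frame L (F x) in
    let u := fun y => line_coord (e (F y)) (t y) in
    mdiff u x v *: e (F x) + u x *: D e (F x) (map_diff F x v).

Definition intertwines W L M (D : connection L) (D' : connection M)
    (phi : bundle_map L M) : Prop :=
  forall x v (s : section L), W x -> smooth_section_near W x s ->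
    phi x (D s x v) = D' (fun y => phi y (s y)) x v.

Definition preserves_metric W L (h : metric L) (D : connection L) : Prop :=
  forall x v (s t : section L), W x ->
    smooth_section_near W x s -> smooth_section_near W x t ->
    mdiff (fun y => h y (s y) (t y)) x v =
      h x (D s x v) (t x) + h x (s x) (D t x v).

Definition dbar L (s : section L) (x : X) (v : tangent x) : L x :=
  mdbar (fun y => line_coord (frame L x y) (s y)) x v *: frame L x x.

Arguments dbar {L} s x v.

Definition part01 L (D : connection L) : connection L :=
  fun s x v => 2^-1 *: (D s x v + 'i *: D s x (imul v)).

Arguments part01 {L} D s x v.

Definition holo_compatible W L (D : connection L) : Prop :=
  forall x v (s : section L), W x -> smooth_section_near W x s ->
    part01 D s x v = dbar s x v.

Definition connection_agree W L (D D' : connection L) : Prop :=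
  forall x v (s : section L), W x -> smooth_section_near W x s ->
    D s x v = D' s x v.

End Bundles.

Arguments tensor_metric {R X L M} h k x t t'.
Arguments pullback_metric {R X} F {L} h x u w : rename.
Arguments dbar {R X L} s x v.
Arguments part01 {R X L} D s x v.
Arguments tensor_connection {R X L M} D D' t x v.
Arguments pullback_connection {R X} F {L} D t x v.

Record action (G : groupType) (T : Type) := Action {
  act :> G -> T -> T;
  act1 : forall x, act 1%g x = x;
  actM : forall g h x, act (g * h)%g x = act g (act h x)
}.

Lemma actMV (G : groupType) (T : Type) (to : action G T) (g h : G) (x : T) :
  to h^-1%g (to g^-1%g x) = to (g * h)^-1%g x.
Proof. by rewrite invgM actM. Qed.

Section Gerbes.
Variables (R : realType) (X : complex_manifold R) (G : groupType).
Variables (aX : action G X) (I : Type) (aI : action G I) (V : I -> set X).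
Local Notation C := R[i].
Local Notation "L ⊗ M" := (tensor_bundle L M) (at level 40, left associativity).

Definition equivariant_open_cover : Prop :=
  [/\ forall a, open (V a),
      \bigcup_a V a = setT &
      forall g a, aX g @` V a = V (aI g a)].

Local Notation pull g L := (pullback_bundle (aX g^-1%g) L).
Local Notation iV g := (aI g^-1%g).

(** [gtriv] and [gdual] are the isomorphisms meant by "L_{a,a} is trivial" and
    "L_{b,a} = L_{a,b}^{-1}". *)
Record gerbe_data := GerbeData {
  gL : I -> I -> bundle X;
  gE : I -> G -> bundle X;
  gtriv : forall a, bundle_map (trivial_bundle (V a)) (gL a a);
  gdual : forall a b, bundle_map (gL b a) (dual_bundle (gL a b));
  gphi3 : forall a b c, bundle_map (gL a c) (gL a b ⊗ gL b c);
  gphi2 : forall a b g,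
    bundle_map (pull g (gL (iV g a) (iV g b)) ⊗ gE b g) (gE a g ⊗ gL a b);
  gphi1 : forall a g h,
    bundle_map (gE a (g * h)%g) (gE a g ⊗ pull g (gE (iV g a) h))
}.

Definition V2 a b : set X := V a `&` V b.
Definition V3 a b c : set X := V a `&` V b `&` V c.
Definition V4 a b c d : set X := V a `&` V b `&` V c `&` V d.

Definition castL (L : I -> I -> bundle X) a a' b b' x x'
    (ea : a = a') (eb : b = b') (ex : x = x') (u : L a b x) : L a' b' x' :=
  match ea in _ = a1, eb in _ = b1, ex in _ = x1 return L a1 b1 x1 with
  | erefl, erefl, erefl => u
  end.

Definition castE (E : I -> G -> bundle X) a a' g g' x x'
    (ea : a = a') (eg : g = g') (ex : x = x') (u : E a g x) : E a' g' x' :=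
  match ea in _ = a1, eg in _ = g1, ex in _ = x1 return E a1 g1 x1 with
  | erefl, erefl, erefl => u
  end.

Section Coherence.
Variable gb : gerbe_data.
Local Notation L := (gL gb).
Local Notation E := (gE gb).

(** The pairing L_{b,a} ⊗ L_{a,b} -> C given by [gdual]. *)
Definition pairing a b x (u : L b a x) (w : L a b x) : C :=
  (gdual gb a b x u : 'Hom(L a b x, C^o)) w.

(** The identifications of L_{a,b}^{-1} with L_{b,a} are symmetric, and
    compatible with the trivialization of L_{a,a}. *)
Definition inverse_normalized : Prop :=
  (forall a b x (u : L b a x) (w : L a b x), V2 a b x ->
     pairing u w = pairing w u) /\
  (forall a x, V a x ->
     pairing (gtriv gb a x (1 : C^o)) (gtriv gb a x (1 : C^o)) = 1).

(** phi_{a,b,c} at x, viewed in L_{a,b} ⊗ L_{b,c} ⊗ L_{c,a} by means of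
    L_{c,a} = L_{a,c}^{-1}, is p ⊗ q ⊗ r. *)
Definition phi3_value a b c x (p : L a b x) (q : L b c x) (r : L c a x) : Prop :=
  forall w : L a c x, gphi3 gb a b c x w = pairing r w *: pure p q.

(** Interchanging two indices changes phi_{a,b,c} into its inverse, for the
    pairing of L_{a,b} ⊗ L_{b,c} ⊗ L_{c,a} with the tensor product of
    L_{b,a}, L_{c,b}, L_{a,c}.  All vectors of a tensor product of lines are
    pure tensors. *)
Definition skew_symmetric : Prop :=
  forall a b c x (p : L a b x) (q : L b c x) (r : L c a x), V3 a b c x ->
    phi3_value p q r ->
    [/\ forall (p' : L b a x) (r' : L a c x) (q' : L c b x),
          phi3_value p' r' q' -> pairing p' p * pairing q' q * pairing r' r = 1,
        forall (r' : L a c x) (q' : L c b x) (p' : L b a x),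
          phi3_value r' q' p' -> pairing p' p * pairing q' q * pairing r' r = 1 &
        forall (q' : L c b x) (p' : L b a x) (r' : L a c x),
          phi3_value q' p' r' -> pairing p' p * pairing q' q * pairing r' r = 1].

Definition coherent_03 : Prop :=
  forall a b c d x (u : L a d x), V4 a b c d x ->
    tassoc (tmap (gphi3 gb a b c x) id (gphi3 gb a c d x u)) =
    tmap id (gphi3 gb b c d x) (gphi3 gb a b d x u).

(** From (g^-1)^*L_{g^-1 a,g^-1 c} ⊗ L_c(g)
    to L_a(g) ⊗ (L_{a,b} ⊗ L_{b,c}). *)
Definition coherent_12 : Prop :=
  forall a b c g x
    (u : (pull g (L (iV g a) (iV g c)) ⊗ E c g) x), V3 a b c x ->
    tmap id (gphi3 gb a b c x) (gphi2 gb a c g x u) =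
    tassoc (tmap (gphi2 gb a b g x) id
      (tassocV (tmap id (gphi2 gb b c g x)
        (tassoc (tmap (gphi3 gb (iV g a) (iV g b) (iV g c) (aX g^-1%g x)) id
          u))))).

(** From ((gh)^-1)^*L_{(gh)^-1 a,(gh)^-1 b} ⊗ L_b(gh)
    to (L_a(g) ⊗ (g^-1)^*L_{g^-1 a}(h)) ⊗ L_{a,b}. *)
Definition coherent_21 : Prop :=
  forall a b g h x
    (s : L (iV h (iV g a)) (iV h (iV g b)) (aX h^-1%g (aX g^-1%g x)))
    (w : E b (g * h)%g x), V2 a b x ->
    tmap (gphi1 gb a g h x) id
      (gphi2 gb a b (g * h)%g x
        (pure (castL (actMV aI g h a) (actMV aI g h b) (actMV aX g h x) s) w)) =
    tmap (tswap (A := _) (B := _)) id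
      (tassocV (tmap id (gphi2 gb a b g x)
        (tassoc (tmap (gphi2 gb (iV g a) (iV g b) h (aX g^-1%g x)) id
          (tassocV (tmap id (tswap (A := _) (B := _))
            (pure s (gphi1 gb b g h x w)))))))).

(** From L_a(ghk) to
    L_a(g) ⊗ ((g^-1)^*L_{g^-1 a}(h) ⊗ ((gh)^-1)^*L_{(gh)^-1 a}(k)). *)
Definition coherent_30 : Prop :=
  forall a g h k x (u : E a (g * (h * k))%g x), V a x ->
    tmap id (gphi1 gb (iV g a) h k (aX g^-1%g x)) (gphi1 gb a g (h * k)%g x u) =
    tassoc (tmap (gphi1 gb a g h x)
        (castE (esym (actMV aI g h a)) (erefl k) (esym (actMV aX g h x)))
      (gphi1 gb a (g * h)%g k x (castE (erefl a) (mulgA g h k) (erefl x) u))).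

End Coherence.

Record equivariant_gerbe := EquivariantGerbe {
  gerbe :> gerbe_data;
  gL_line : forall a b, is_line_bundle (V2 a b) (gL gerbe a b);
  gE_line : forall a g, is_line_bundle (V a) (gE gerbe a g);
  gtriv_iso : forall a, holo_iso (V a) (gtriv gerbe a);
  gdual_iso : forall a b, holo_iso (V2 a b) (gdual gerbe a b);
  gphi3_iso : forall a b c, holo_iso (V3 a b c) (gphi3 gerbe a b c);
  gphi2_iso : forall a b g, holo_iso (V2 a b) (gphi2 gerbe a b g);
  gphi1_iso : forall a g h, holo_iso (V a) (gphi1 gerbe a g h);
  gerbe_inverse : inverse_normalized gerbe;
  gerbe_skew : skew_symmetric gerbe;
  gerbe_03 : coherent_03 gerbe;
  gerbe_12 : coherent_12 gerbe;
  gerbe_21 : coherent_21 gerbe;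
  gerbe_30 : coherent_30 gerbe
}.

Record hermitian_structure (gb : equivariant_gerbe) := HermitianStructure {
  hL : forall a b, metric (gL gb a b);
  hE : forall a g, metric (gE gb a g);
  hL_metric : forall a b, is_metric (V2 a b) (@hL a b);
  hE_metric : forall a g, is_metric (V a) (@hE a g);
  gphi3_unitary : forall a b c,
    unitary (V3 a b c) (@hL a c) (tensor_metric (@hL a b) (@hL b c))
      (gphi3 gb a b c);
  gphi2_unitary : forall a b g,
    unitary (V2 a b)
      (tensor_metric (pullback_metric (aX g^-1%g) (@hL (iV g a) (iV g b)))
        (@hE b g))
      (tensor_metric (@hE a g) (@hL a b)) (gphi2 gb a b g);
  gphi1_unitary : forall a g h,
    unitary (V a) (@hE a (g * h)%g)
      (tensor_metric (@hE a g)
        (pullback_metric (aX g^-1%g) (@hE (iV g a) h)))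
      (gphi1 gb a g h)
}.

Arguments hL {gb} h a b : rename.
Arguments hE {gb} h a g : rename.

Record connections (gb : gerbe_data) := Connections {
  nL : forall a b, connection (gL gb a b);
  nE : forall a g, connection (gE gb a g)
}.

Arguments nL {gb} D a b : rename.
Arguments nE {gb} D a g : rename.

Definition connective_structure (gb : gerbe_data) (D : connections gb) : Prop :=
  [/\ forall a b, is_connection (V2 a b) (nL D a b),
      forall a g, is_connection (V a) (nE D a g),
      forall a b c,
        intertwines (V3 a b c) (nL D a c)
          (tensor_connection (nL D a b) (nL D b c)) (gphi3 gb a b c),
      forall a b g,
        intertwines (V2 a b)
          (tensor_connection
            (pullback_connection (aX g^-1%g) (nL D (iV g a) (iV g b)))
            (nE D b g))
          (tensor_connection (nE D a g) (nL D a b)) (gphi2 gb a b g) &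
      forall a g h,
        intertwines (V a) (nE D a (g * h)%g)
          (tensor_connection (nE D a g)
            (pullback_connection (aX g^-1%g) (nE D (iV g a) h)))
          (gphi1 gb a g h)].

Definition compatible_connective_structure (gb : equivariant_gerbe)
    (h : hermitian_structure gb) (D : connections gb) : Prop :=
  [/\ connective_structure D,
      forall a b, preserves_metric (V2 a b) (hL h a b) (nL D a b),
      forall a g, preserves_metric (V a) (hE h a g) (nE D a g),
      forall a b, holo_compatible (V2 a b) (nL D a b) &
      forall a g, holo_compatible (V a) (nE D a g)].

(** Equality as operators on smooth local sections, the values of a
    [connection] on other arguments being irrelevant. *)
Definition same_connections (gb : gerbe_data) (D D' : connections gb) : Prop :=
  (forall a b, connection_agree (V2 a b) (nL D a b) (nL D' a b)) /\
  (forall a g, connection_agree (V a) (nE D a g) (nE D' a g)).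

End Gerbes.

Arguments hL {R X G aX I aI V gb} h a b : rename.
Arguments hE {R X G aX I aI V gb} h a g : rename.
Arguments nL {R X G aX I aI V gb} D a b : rename.
Arguments nE {R X G aX I aI V gb} D a g : rename.

(* Main.v *)
Require Import Defs.
From HB Require Import structures.
From mathcomp Require Import all_boot all_order all_algebra.
From mathcomp Require Import all_classical all_reals all_analysis.
From mathcomp Require Import complex ring.

(** A holomorphic hermitian line bundle carries exactly one connection which
    preserves the metric and whose (0,1)-part is dbar: in a holomorphic frame of
    square length H its form is d'H/H.  A nonvanishing holomorphic g satisfies
    d' log |g|^2 = dg/g, so this form transforms as a connection form under
    a holomorphic change of frame, and more generally every unitary holomorphic
    isomorphism intertwines these connections.  As the square lengths of frames
    are multiplied by tensor products and composed with F by the pullback along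
    a holomorphic map F, the construction commutes with both operations.  Hence
    these connections are compatible with the structure maps of the gerbe, whose
    coherence conditions play no role, and uniqueness holds bundle by bundle. *)

Set Implicit Arguments.
Unset Strict Implicit.
Unset Printing Implicit Defensive.

Import Order.TTheory GRing.Theory Num.Theory.
Import numFieldNormedType.Exports.

Local Open Scope classical_set_scope.
Local Open Scope ring_scope.

(** * Functions of class C^k *)

(** Charts and frames are attached to points: [mdiff] at x reads the chart around x, and the Chern
    connection at x is written in the frame around x. The connection is thus defined everywhere
    without gluing, but both choices jump with x, so smoothness in x is what has to be earned.
    [mdiff_coord_field] replaces the jumping chart by a fixed one, and [chern_frame] does the same
    for the frame. Functions and sections are total, with arbitrary values off their domains. Hence
    identities between derivatives go through germs ([near_eq_is_diff] and its descendants). Tensor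
    and pulled-back connections are given by formulas in frames, not as Chern connections of a
    metric. The pointwise relation [chern_at] recognises the formula d'H/H in them, without first
    proving that the tensor or pulled-back metric is smooth. One identity, [dlog_frame_change], then
    serves twice: for two frames of one bundle, and for a frame and the image of another under an
    isomorphism. Logarithms never occur, d' log H being replaced by d'H/H. *)

Section RealCalculus.
Variable R : realType.

(** The first-order expansion of [g] at [z] is that of [f], since it only sees the germ. As ['d] is
    a chosen linear map, uniqueness of the expansion is then needed to identify ['d g z]. *)
Lemma near_eq_is_diff (E W : normedModType R) (f g : E -> W) z :
  (\forall y \near z, f y = g y) -> differentiable f z ->
  is_diff z g ('d f z).
Proof.
move=> fg df.
have key : continuous ('d f z) /\ g \o shift z = cst (g z) + 'd f z +o_ 0 id.
  split; first exact: diff_continuous.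
  apply/eqaddoP => e e0.
  have /eqaddoP/(_ e e0) := diff_locally df.
  have fg0 : \forall y \near (0 : E), f (y + z) = g (y + z).
    by have := fg; rewrite (near_shift 0) subr0.
  have fgz : f z = g z by exact: nbhs_singleton fg.
  apply: filter_app; near=> y.
  move=> H.
  suff -> : (g \o shift z - (cst (g z) + 'd f z)) y =
            (f \o shift z - (cst (f z) + 'd f z)) y by [].
  rewrite !fctE fgz; congr (_ - _).
  by symmetry; near: y.
have dg := diff_unique key.1 key.2.
split=> //; apply/diff_locallyP; rewrite dg; exact: key.
Unshelve. all: by end_near.
Qed.

Lemma near_eq_diff (E W : normedModType R) (f g : E -> W) z :
  (\forall y \near z, f y = g y) -> differentiable f z ->
  'd g z = 'd f z :> (E -> W).
Proof. by move=> fg df; have [] := near_eq_is_diff fg df. Qed.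

Lemma near_eq_differentiable (E W : normedModType R) (f g : E -> W) z :
  (\forall y \near z, f y = g y) -> differentiable f z -> differentiable g z.
Proof. by move=> fg df; have [] := near_eq_is_diff fg df. Qed.

Section Ck.
Variable m : nat.
Implicit Types (U : set (cspace R m)) (f g : cspace R m -> R).

Lemma Ck_sub k U U' f : U `<=` U' -> Ck k U' f -> Ck k U f.
Proof.
move=> UU'; elim: k f => [|k IH] f /=; first by move=> cf z /UU' /cf.
by move=> [df cf]; split=> [z /UU' /df|v] //; exact: IH (cf v).
Qed.

(** Differentials are taken in the whole space and do not depend on the set, so at each order the
    condition is a condition at single points. *)
Lemma Ck_local k U f :
  (forall z, U z -> exists2 U', U' z & Ck k U' f) -> Ck k U f.
Proof.
elim: k f => [|k IH] f /= loc.
  by move=> z /loc[U' U'z /(_ _ U'z)].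
split=> [z /loc[U' U'z [/(_ _ U'z)]]|v] //.
by apply: IH => z /loc[U' U'z [_ /(_ v)]]; exists U'.
Qed.

Lemma Ck_eq k U f g : open U -> (forall z, U z -> f z = g z) ->
  Ck k U f -> Ck k U g.
Proof.
move=> oU; elim: k f g => [|k IH] f g fg /= => [cf z Uz|[df cf]].
  have near_fg : \forall y \near z, f y = g y.
    by apply: filterS (open_nbhs_nbhs (conj oU Uz)) => y /fg.
  have : g @ z --> f z by apply: cvg_trans (near_eq_cvg near_fg) (cf z Uz).
  by rewrite (fg _ Uz).
have near_fg z : U z -> \forall y \near z, f y = g y.
  by move=> Uz; apply: filterS (open_nbhs_nbhs (conj oU Uz)) => y /fg.
split=> [z Uz|v].
  exact: (@near_eq_differentiable (cspace R m) R^o f g z (near_fg _ Uz) (df _ Uz)).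
apply: IH (cf v) => z Uz /=.
by rewrite (@near_eq_diff (cspace R m) R^o f g z (near_fg _ Uz) (df _ Uz)).
Qed.

Lemma CkS k U f : Ck k.+1 U f -> Ck k U f.
Proof.
elim: k f => [|k IH] f [df cf].
  by move=> z /df; exact: differentiable_continuous.
by split=> // v; apply: IH (cf v).
Qed.

Lemma Ck_cst k U (a : R) : Ck k U (fun=> a).
Proof.
elim: k a => [|k IH] a /=; first by move=> z _; exact: cvg_cst.
split=> [z _|v]; first exact: differentiable_cst.
suff -> : (fun z => 'd ((fun=> a) : _ -> R^o) z v) = fun=> 0 by exact: IH.
by apply/funext => z; rewrite (diff_cst (a : R^o) z).
Qed.

Lemma CkD k U f g : open U -> Ck k U f -> Ck k U g ->
  Ck k U (fun z => f z + g z).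
Proof.
move=> oU; elim: k f g => [|k IH] f g.
  by move=> cf cg z Uz; apply: cvgD; [exact: cf|exact: cg].
move=> [df cf] [dg cg]; split=> [z Uz|v].
  exact: (@differentiableD _ _ R^o f g z (df z Uz) (dg z Uz)).
apply: Ck_eq (IH _ _ (cf v) (cg v)) => // z Uz.
exact: esym (congr1 (fun h : _ -> _ => h v)
    (@diffD _ _ R^o f g z (df z Uz) (dg z Uz))).
Qed.

Lemma CkM k U f g : open U -> Ck k U f -> Ck k U g ->
  Ck k U (fun z => f z * g z).
Proof.
move=> oU; elim: k f g => [|k IH] f g.
  by move=> cf cg z Uz; apply: cvgM; [exact: cf|exact: cg].
move=> ff gg; have [df cf] := ff; have [dg cg] := gg; split=> [z Uz|v].
  exact: (@differentiableM _ _ f g z (df z Uz) (dg z Uz)).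
have := CkD oU (IH _ _ (CkS ff) (cg v)) (IH _ _ (CkS gg) (cf v)).
apply: Ck_eq => // z Uz.
exact: esym (congr1 (fun h : _ -> _ => h v)
    (@diffM _ _ f g z (df z Uz) (dg z Uz))).
Qed.

Lemma CkN k U f : open U -> Ck k U f -> Ck k U (fun z => - f z).
Proof.
move=> oU cf; apply: Ck_eq (CkM oU (Ck_cst k U (-1)) cf) => // z _.
by rewrite mulN1r.
Qed.

Lemma CkV k U f : open U -> (forall z, U z -> f z != 0) -> Ck k U f ->
  Ck k U (fun z => (f z)^-1).
Proof.
(* [f] stays fixed in the induction: the derivative of 1/f is -(1/f)^2 df, which involves 1/f again,
   one order lower. *)
move=> oU f0; elim: k => [|k IH].
  by move=> cf z Uz; apply: cvgV; [exact: f0|exact: cf].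
move=> ff; have [df cf] := ff; split=> [z Uz|v].
  exact: (@differentiableV _ _ f z (df z Uz) (f0 z Uz)).
have cV := IH (CkS ff).
apply: Ck_eq (CkN oU (CkM oU (CkM oU cV cV) (cf v))) => // z Uz.
have := congr1 (fun h : _ -> _ => h v) (@diffV _ _ f z (df z Uz) (f0 z Uz)).
move=> /esym; apply: etrans.
by rewrite -mulNr -expr2 -exprVn.
Qed.

Lemma Ck_sum k U n (f : 'I_n -> cspace R m -> R) : open U ->
  (forall i, Ck k U (f i)) -> Ck k U (fun z => \sum_i f i z).
Proof.
move=> oU; elim: n f => [|n IH] f cf.
  by apply: Ck_eq (Ck_cst k U 0) => // z _; rewrite big_ord0.
apply: Ck_eq (CkD oU (cf ord0) (IH (fun i => f (lift ord0 i)) _)) => //.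
by move=> z _; rewrite big_ord_recl.
Qed.

End Ck.

Definition cre n (j : 'I_n) (z : cspace R n) : R := z.1 ord0 j.
Definition cim n (j : 'I_n) (z : cspace R n) : R := z.2 ord0 j.
Definition ere n (j : 'I_n) : cspace R n := (delta_mx ord0 j, 0).
Definition eim n (j : 'I_n) : cspace R n := (0, delta_mx ord0 j).

Lemma cspace_sum n (z : cspace R n) :
  z = \sum_j cre j z *: ere j + \sum_j cim j z *: eim j.
Proof.
case: z => a b; rewrite /cre /cim /ere /eim /=.
apply: injective_projections => /=.
  rewrite raddf_sum raddf_sum /= [X in _ + X]big1 ?addr0; last first.
    by move=> j _; rewrite scaler0.
  by rewrite {1}[a]row_sum_delta.
rewrite raddf_sum raddf_sum /= [X in X + _]big1 ?add0r; last first.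
  by move=> j _; rewrite scaler0.
by rewrite {1}[b]row_sum_delta.
Qed.

Lemma is_diff_cre n (j : 'I_n) (z : cspace R n) :
  is_diff z (cre j : _ -> R^o) (cre j).
Proof.
have lin : linear (cre j : cspace R n -> R^o) by move=> a u v; rewrite /cre /= !mxE.
pose L := GRing.isLinear.Build _ _ _ _ _ lin.
pose F : {linear cspace R n -> R^o} := HB.pack (cre j : _ -> R^o) L.
have cF : continuous F.
  move=> y; apply: (@continuous_comp _ _ _ fst (fun M : 'rV[R]_n => M ord0 j)).
    exact: cvg_fst.
  exact: coord_continuous.
by split; [exact: (@linear_differentiable _ _ _ F)|exact: (@diff_lin _ _ _ F)].
Qed.

Lemma is_diff_cim n (j : 'I_n) (z : cspace R n) :
  is_diff z (cim j : _ -> R^o) (cim j).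
Proof.
have lin : linear (cim j : cspace R n -> R^o) by move=> a u v; rewrite /cim /= !mxE.
pose L := GRing.isLinear.Build _ _ _ _ _ lin.
pose F : {linear cspace R n -> R^o} := HB.pack (cim j : _ -> R^o) L.
have cF : continuous F.
  move=> y; apply: (@continuous_comp _ _ _ snd (fun M : 'rV[R]_n => M ord0 j)).
    exact: cvg_snd.
  exact: coord_continuous.
by split; [exact: (@linear_differentiable _ _ _ F)|exact: (@diff_lin _ _ _ F)].
Qed.

Section IntoCspace.
Variables (E : normedModType R) (n : nat) (F : E -> cspace R n).

Lemma differentiable_cspace z :
  (forall j, differentiable (cre j \o F : _ -> R^o) z) ->
  (forall j, differentiable (cim j \o F : _ -> R^o) z) -> differentiable F z.
Proof.
move=> dr di.
have -> : F = (\sum_j (fun z => cre j (F z) *: ere j)) +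
              (\sum_j (fun z => cim j (F z) *: eim j)).
  apply/funext => y; rewrite {1}[F y]cspace_sum.
  by rewrite fctE !fct_sumE.
apply: differentiableD; apply: differentiable_sum => j.
  exact: (@differentiableZl _ _ _ (cre j \o F)).
exact: (@differentiableZl _ _ _ (cim j \o F)).
Qed.

Lemma diff_cre j z v : differentiable F z ->
  'd (cre j \o F : _ -> R^o) z v = cre j ('d F z v).
Proof.
move=> dF; have [d1 d2] := is_diff_cre j (F z).
by rewrite (diff_comp dF d1) /= d2.
Qed.

Lemma diff_cim j z v : differentiable F z ->
  'd (cim j \o F : _ -> R^o) z v = cim j ('d F z v).
Proof.
move=> dF; have [d1 d2] := is_diff_cim j (F z).
by rewrite (diff_comp dF d1) /= d2.
Qed.

End IntoCspace.

Lemma linear_cspace_sum n (l : {linear cspace R n -> R^o}) w :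
  l w = \sum_j cre j w * l (ere j) + \sum_j cim j w * l (eim j).
Proof.
rewrite {1}(cspace_sum w).
rewrite raddfD !raddf_sum.
congr (_ + _); apply: eq_bigr => j _.
  exact: linearZ_LR.
exact: linearZ_LR.
Qed.

(** [Ck] only speaks of derivatives in a constant direction, whereas the chain rule differentiates
    [f] in the direction ['d F z v], which moves with [z]. Expanding this direction in the real
    basis [ere], [eim] gives a sum of products of derivatives of the coordinates of [F] with partial
    derivatives of [f] composed with [F], to which the induction applies. *)
Lemma Ck_comp k m n (U : set (cspace R m)) (U' : set (cspace R n))
    (F : cspace R m -> cspace R n) (f : cspace R n -> R) :
  open U -> (forall z, U z -> U' (F z)) ->
  (forall z, U z -> differentiable F z) ->
  (forall j, Ck k U (cre j \o F)) -> (forall j, Ck k U (cim j \o F)) ->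
  Ck k U' f -> Ck k U (f \o F).
Proof.
move=> oU UU' dF; elim: k f => [|k IH] f Fr Fi.
  move=> cf z Uz; apply: continuous_comp; last exact/cf/UU'.
  exact: differentiable_continuous (dF z Uz).
move=> [df cf]; split=> [z Uz|v].
  by apply: differentiable_comp; [exact: dF|exact/df/UU'].
have Fr' j : Ck k U (cre j \o F) by exact: CkS.
have Fi' j : Ck k U (cim j \o F) by exact: CkS.
have cr j := CkM oU ((Fr j).2 v) (IH _ Fr' Fi' (cf (ere j))).
have ci j := CkM oU ((Fi j).2 v) (IH _ Fr' Fi' (cf (eim j))).
apply: Ck_eq (CkD oU (Ck_sum oU cr) (Ck_sum oU ci)) => // z Uz.
have dFz := dF z Uz.
have dfz : differentiable (f : _ -> R^o) (F z) := df _ (UU' _ Uz).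
have dcomp_z := congr1 (fun h : _ -> _ => h v)
  (@diff_comp _ _ _ R^o F f z dFz dfz).
move: dcomp_z => /esym; apply: etrans.
rewrite /= linear_cspace_sum.
by congr (_ + _); apply: eq_bigr => j _; rewrite -(diff_cre, diff_cim).
Qed.

End RealCalculus.

(** * Complex-valued functions and holomorphic maps on open subsets of C^m *)

Section ComplexCalculus.
Variable R : realType.
Local Notation C := R[i].

Lemma eq_Complex (a b c d : R) : a = c -> b = d -> Complex a b = Complex c d.
Proof. by move=> -> ->. Qed.

Lemma complex_eta (c : C) : c = Complex (complex.Re c) (complex.Im c).
Proof. by case: c. Qed.

(** The right-hand side keeps the order of terms in which [diffM] states the Leibniz rule for the
    real and imaginary parts. *)
Lemma leibniz_Complex (a b c d p q r s : R) :
  Complex p q * Complex c d + Complex a b * Complex r s =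
  Complex ((a * r + c * p) - (b * s + d * q)) ((a * s + d * p) + (b * r + c * q)).
Proof. by apply: eq_Complex => /=; ring. Qed.

Section Functions.
Variable m : nat.
Implicit Types (U : set (cspace R m)) (f g : cspace R m -> C) (z v : cspace R m).

Definition cdifferentiable f z :=
  differentiable ((fun y => complex.Re (f y)) : _ -> R^o) z /\
  differentiable ((fun y => complex.Im (f y)) : _ -> R^o) z.

Lemma csmooth_cdifferentiable U f z : csmooth U f -> U z -> cdifferentiable f z.
Proof. by move=> /(_ 1%N) [[+ _] [+ _]] Uz => /(_ _ Uz) + /(_ _ Uz). Qed.

Lemma csmooth_sub U U' f : U `<=` U' -> csmooth U' f -> csmooth U f.
Proof. by move=> UU' sf k; have [? ?] := sf k; split; apply: Ck_sub UU' _. Qed.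

Lemma csmooth_local U f :
  (forall z, U z -> exists2 U', U' z & csmooth U' f) -> csmooth U f.
Proof.
by move=> loc k; split; apply: Ck_local => z /loc[U' U'z /(_ k) []]; exists U'.
Qed.

Lemma csmooth_eq U f g : open U -> (forall z, U z -> f z = g z) ->
  csmooth U f -> csmooth U g.
Proof.
move=> oU fg sf k; have [fr fi] := sf k.
by split; [apply: Ck_eq fr | apply: Ck_eq fi] => // z /fg ->.
Qed.

Lemma csmooth_cst U (a : C) : csmooth U (fun=> a).
Proof. by move=> k; split; exact: Ck_cst. Qed.

Lemma csmoothD U f g : open U -> csmooth U f -> csmooth U g ->
  csmooth U (fun z => f z + g z).
Proof.
move=> oU sf sg k; have [fr fi] := sf k; have [gr gi] := sg k.
split; [apply: Ck_eq (CkD oU fr gr)|apply: Ck_eq (CkD oU fi gi)] => // z _;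
  by case: (f z) (g z) => ? ? [? ?].
Qed.

Lemma csmoothM U f g : open U -> csmooth U f -> csmooth U g ->
  csmooth U (fun z => f z * g z).
Proof.
move=> oU sf sg k; have [fr fi] := sf k; have [gr gi] := sg k.
split.
  apply: Ck_eq (CkD oU (CkM oU fr gr) (CkN oU (CkM oU fi gi))) => // z _.
  by case: (f z) (g z) => ? ? [? ?].
apply: Ck_eq (CkD oU (CkM oU fr gi) (CkM oU fi gr)) => // z _.
by case: (f z) (g z) => ? ? [? ?].
Qed.

(** 1/f is the conjugate of f divided by |f|^2, so the real case applies to the squared modulus. *)
Lemma csmoothV U f : open U -> (forall z, U z -> f z != 0) -> csmooth U f ->
  csmooth U (fun z => (f z)^-1).
Proof.
move=> oU f0 sf k; have [fr fi] := sf k.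
have n0 z : U z -> complex.Re (f z) * complex.Re (f z) +
                   complex.Im (f z) * complex.Im (f z) != 0.
  move=> /f0; apply: contra; rewrite -!expr2 paddr_eq0 ?sqr_ge0 //.
  by rewrite !sqrf_eq0 eq_complex.
have nV := CkV oU n0 (CkD oU (CkM oU fr fr) (CkM oU fi fi)).
split.
  apply: Ck_eq (CkM oU fr nV) => // z _.
  by rewrite -!expr2; case: (f z).
apply: Ck_eq (CkN oU (CkM oU fi nV)) => // z _.
by rewrite -!expr2; case: (f z).
Qed.

Lemma csmooth_cdiff U f v : csmooth U f -> csmooth U (fun z => cdiff f z v).
Proof.
by move=> sf k; have [[_ fr] [_ fi]] := sf k.+1; split; [exact: fr|exact: fi].
Qed.

Lemma near_eq_cdiff f g z : (\forall y \near z, f y = g y) ->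
  cdifferentiable f z ->
  cdifferentiable g z /\ forall v, cdiff g z v = cdiff f z v.
Proof.
move=> fg [dr di].
have fgr : \forall y \near z, complex.Re (f y) = complex.Re (g y).
  by apply: filterS fg => y ->.
have fgi : \forall y \near z, complex.Im (f y) = complex.Im (g y).
  by apply: filterS fg => y ->.
have [dr' er] := @near_eq_is_diff _ _ R^o _ _ z fgr dr.
have [di' ei] := @near_eq_is_diff _ _ R^o _ _ z fgi di.
split=> [|v]; first by split.
apply: eq_Complex.
  exact: (congr1 (fun h : cspace R m -> R^o => h v) er).
exact: (congr1 (fun h : cspace R m -> R^o => h v) ei).
Qed.

Lemma cdifferentiable_cst (a : C) z : cdifferentiable (fun=> a) z.
Proof. by split; exact: differentiable_cst. Qed.

Lemma cdiff_cst (a : C) z v : cdiff (fun=> a) z v = 0.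
Proof.
apply: eq_Complex.
  exact: (congr1 (fun h : cspace R m -> R^o => h v)
    (diff_cst (complex.Re a : R^o) z)).
exact: (congr1 (fun h : cspace R m -> R^o => h v)
  (diff_cst (complex.Im a : R^o) z)).
Qed.

Lemma cdiff_lin f z (a : R) v w :
  cdiff f z (a *: v + w) = a%:C%C * cdiff f z v + cdiff f z w.
Proof.
have linR (l : {linear cspace R m -> R^o}) : l (a *: v + w) = a * l v + l w.
  exact: linearP.
apply/eqP; rewrite eq_complex; apply/andP; split; apply/eqP => /=.
  by rewrite mul0r subr0; exact: linR.
by rewrite mul0r addr0; exact: linR.
Qed.

Lemma cdiffN f z v : cdiff f z (- v) = - cdiff f z v.
Proof.
have linN (l : {linear cspace R m -> R^o}) : l (- v) = - l v by exact: raddfN.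
by apply: eq_Complex; exact: linN.
Qed.

Lemma cdiffD f g z : cdifferentiable f z -> cdifferentiable g z ->
  cdifferentiable (fun y => f y + g y) z /\
  forall v, cdiff (fun y => f y + g y) z v = cdiff f z v + cdiff g z v.
Proof.
move=> [fr fi] [gr gi].
have er := @diffD _ _ R^o _ _ z fr gr; have ei := @diffD _ _ R^o _ _ z fi gi.
have dr := @differentiableD _ _ R^o _ _ z fr gr.
have di := @differentiableD _ _ R^o _ _ z fi gi.
have -> : (fun y => f y + g y) = fun y => Complex
    (complex.Re (f y) + complex.Re (g y)) (complex.Im (f y) + complex.Im (g y)).
  by apply/funext => y; case: (f y) (g y) => ? ? [? ?].
split=> [|v]; first by split.
apply: eq_Complex.
  exact: (congr1 (fun h : cspace R m -> R^o => h v) er).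
exact: (congr1 (fun h : cspace R m -> R^o => h v) ei).
Qed.

Lemma cdiffM f g z : cdifferentiable f z -> cdifferentiable g z ->
  cdifferentiable (fun y => f y * g y) z /\
  forall v, cdiff (fun y => f y * g y) z v = cdiff f z v * g z + f z * cdiff g z v.
Proof.
move=> [fr fi] [gr gi].
pose re (h : cspace R m -> C) y : R^o := complex.Re (h y).
pose im (h : cspace R m -> C) y : R^o := complex.Im (h y).
have -> : (fun y => f y * g y) = fun y => Complex
    (re f y * re g y - im f y * im g y) (re f y * im g y + im f y * re g y).
  by rewrite /re /im; apply/funext => y; case: (f y) (g y) => ? ? [? ?].
have d1 := @differentiableM _ _ (re f) (re g) z fr gr.
have d2 := @differentiableM _ _ (im f) (im g) z fi gi.
have d3 := @differentiableM _ _ (re f) (im g) z fr gi.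
have d4 := @differentiableM _ _ (im f) (re g) z fi gr.
have e1 := @diffM _ _ (re f) (re g) z fr gr.
have e2 := @diffM _ _ (im f) (im g) z fi gi.
have e3 := @diffM _ _ (re f) (im g) z fr gi.
have e4 := @diffM _ _ (im f) (re g) z fi gr.
have e12 := @diffB _ _ R^o _ _ z d1 d2.
have e34 := @diffD _ _ R^o _ _ z d3 d4.
split=> [|v].
  split; first exact: (@differentiableB _ _ R^o _ _ z d1 d2).
  exact: (@differentiableD _ _ R^o _ _ z d3 d4).
transitivity (Complex
    ((re f z * 'd (re g) z v + re g z * 'd (re f) z v) -
     (im f z * 'd (im g) z v + im g z * 'd (im f) z v))
    ((re f z * 'd (im g) z v + im g z * 'd (re f) z v) +
     (im f z * 'd (re g) z v + re g z * 'd (im f) z v))).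
  apply: eq_Complex.
    apply: etrans (congr1 (fun h : cspace R m -> R^o => h v) e12) _ => /=.
    congr (_ - _).
      exact: (congr1 (fun h => h v) e1).
    exact: (congr1 (fun h => h v) e2).
  apply: etrans (congr1 (fun h : cspace R m -> R^o => h v) e34) _ => /=.
  congr (_ + _).
    exact: (congr1 (fun h => h v) e3).
  exact: (congr1 (fun h => h v) e4).
rewrite (complex_eta (f z)) (complex_eta (g z)).
exact: esym (leibniz_Complex _ _ _ _ _ _ _ _).
Qed.

Lemma cdiff_conj f z : cdifferentiable f z ->
  cdifferentiable (fun y => (f y)^*) z /\
  forall v, cdiff (fun y => (f y)^*) z v = (cdiff f z v)^*.
Proof.
move=> [fr fi].
have ei := @diffN _ _ R^o _ z fi.
have di := @differentiableN _ _ R^o _ z fi.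
have -> : (fun y => (f y)^*) = fun y => Complex
    (complex.Re (f y)) (- complex.Im (f y)).
  by apply/funext => y; case: (f y).
split=> [|v]; first by split.
apply: eq_Complex => //.
exact: (congr1 (fun h : cspace R m -> R^o => h v) ei).
Qed.

End Functions.

Section Composition.
Variables (m n : nat) (U : set (cspace R m)) (F : cspace R m -> cspace R n).

Lemma cdiff_comp (f : cspace R n -> C) z :
  differentiable F z -> cdifferentiable f (F z) ->
  cdifferentiable (f \o F) z /\
  forall v, cdiff (f \o F) z v = cdiff f (F z) ('d F z v).
Proof.
move=> dF [dr di]; split=> [|v].
  split; first exact: (@differentiable_comp _ _ _ R^o F _ z dF dr).
  exact: (@differentiable_comp _ _ _ R^o F _ z dF di).
apply: eq_Complex.
  exact: (congr1 (fun h => h v) (@diff_comp _ _ _ R^o F _ z dF dr)).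
exact: (congr1 (fun h => h v) (@diff_comp _ _ _ R^o F _ z dF di)).
Qed.

Hypothesis holF : cholo_map U F.

Lemma cholo_map_Ck k j : Ck k U (cre j \o F) /\ Ck k U (cim j \o F).
Proof. by have [/(_ k) [? ?] _] := holF j. Qed.

Lemma cholo_map_differentiable z : U z -> differentiable F z.
Proof.
move=> Uz; apply: differentiable_cspace => j.
  by have [[/(_ z Uz) ? _] _] := cholo_map_Ck 1 j.
by have [_ [/(_ z Uz) ? _]] := cholo_map_Ck 1 j.
Qed.

(** The Cauchy-Riemann equations of all coordinates, put together: [imul] is multiplication by i on
    C^m. *)
Lemma cholo_map_imul z v : U z -> 'd F z (imul v) = imul ('d F z v).
Proof.
move=> Uz; have dF := cholo_map_differentiable Uz.
have CR j : cre j ('d F z (imul v)) = - cim j ('d F z v) /\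
            cim j ('d F z (imul v)) = cre j ('d F z v).
  have [_ /(_ z v Uz)] := holF j.
  have e w : cdiff (fun y => Complex ((F y).1 ord0 j) ((F y).2 ord0 j)) z w =
             Complex (cre j ('d F z w)) (cim j ('d F z w)).
    by apply: eq_Complex; [exact: diff_cre|exact: diff_cim].
  rewrite !e => -[-> ->]; rewrite !mul0r !mul1r.
  by rewrite sub0r add0r.
apply: injective_projections; apply/rowP => j; rewrite /imul /=.
  by rewrite mxE; exact: (CR j).1.
exact: (CR j).2.
Qed.

Lemma csmooth_comp (U' : set (cspace R n)) (f : cspace R n -> C) :
  open U -> (forall z, U z -> U' (F z)) -> csmooth U' f -> csmooth U (f \o F).
Proof.
move=> oU UU' sf k; have [fr fi] := sf k.
have Fr j := (cholo_map_Ck k j).1; have Fi j := (cholo_map_Ck k j).2.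
have dF := cholo_map_differentiable.
by split; [apply: Ck_comp fr|apply: Ck_comp fi].
Qed.

Lemma cholo_comp (U' : set (cspace R n)) (f : cspace R n -> C) :
  open U -> (forall z, U z -> U' (F z)) -> cholo U' f -> cholo U (f \o F).
Proof.
move=> oU UU' [sf hf]; split; first exact: csmooth_comp sf.
move=> z v Uz; have dF := cholo_map_differentiable Uz.
have [_ e] := cdiff_comp dF (csmooth_cdifferentiable sf (UU' z Uz)).
by rewrite !e cholo_map_imul // hf //; exact: UU'.
Qed.

End Composition.

Section Holomorphic.
Variable m : nat.
Implicit Types (U : set (cspace R m)) (f g : cspace R m -> C) (z v : cspace R m).

Lemma cholo_sub U U' f : U `<=` U' -> cholo U' f -> cholo U f.
Proof.
by move=> UU' [sf hf]; split=> [|z v /UU']; [exact: csmooth_sub sf|exact: hf].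
Qed.

Lemma cholo_local U f :
  (forall z, U z -> exists2 U', U' z & cholo U' f) -> cholo U f.
Proof.
move=> loc; split; first by apply: csmooth_local => z /loc[U' ? []]; exists U'.
by move=> z v /loc[U' U'z [_ /(_ z v U'z)]].
Qed.

Lemma cholo_eq U f g : open U -> (forall z, U z -> f z = g z) ->
  cholo U f -> cholo U g.
Proof.
move=> oU fg [sf hf]; split; first exact: csmooth_eq sf.
move=> z v Uz; have fgz : \forall y \near z, f y = g y.
  by apply: filterS (open_nbhs_nbhs (conj oU Uz)) => y /fg.
by have [_ e] := near_eq_cdiff fgz (csmooth_cdifferentiable sf Uz); rewrite !e hf.
Qed.

Lemma choloM U f g : open U -> cholo U f -> cholo U g ->
  cholo U (fun z => f z * g z).
Proof.
move=> oU [sf hf] [sg hg]; split; first exact: csmoothM.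
move=> z v Uz; have [_ e] := cdiffM (csmooth_cdifferentiable sf Uz)
  (csmooth_cdifferentiable sg Uz).
by rewrite !e hf // hg // mulrDr (mulrCA (f z)) -mulrA.
Qed.

End Holomorphic.

End ComplexCalculus.

(** * Calculus on complex manifolds *)

Section ManifoldCalculus.
Variables (R : realType) (X : complex_manifold R).
Local Notation C := R[i].
Implicit Types (U : set X) (f g : X -> C) (c d : chart X).

Lemma cdom_near c x : cdom c x -> \forall y \near x, cdom c y.
Proof. by move=> cx; apply: open_nbhs_nbhs; split=> //; exact: open_cdom. Qed.

Lemma cinv_near c x (P : X -> Prop) : cdom c x -> (\forall y \near x, P y) ->
  \forall z \near cmap c x, P (cinv c z).
Proof.
move=> cx Px; have cz : (cmap c @` cdom c) (cmap c x) by exists x.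
have : @cinv _ X c @ cmap c x --> cinv c (cmap c x) by exact: continuous_cinv.
by rewrite (cmapK cx); apply.
Qed.

Lemma cimg_near c x : cdom c x ->
  \forall z \near cmap c x, (cmap c @` cdom c) z.
Proof.
move=> cx; apply: open_nbhs_nbhs; split; first exact: open_cimg.
by exists x.
Qed.

Lemma open_cmap_image c U : open U -> open (cmap c @` (U `&` cdom c)).
Proof.
move=> oU; rewrite openE => _ [x [Ux cx] <-].
have Unx : \forall y \near x, U y by exact: open_nbhs_nbhs.
have := cimg_near cx; apply: filterS2 (cinv_near cx Unx) => z Uz [y cy yz].
by exists y => //; split=> //; move: Uz; rewrite -yz cmapK.
Qed.

Arguments open_cmap_image c [U] _.

Definition mdifferentiable f x :=
  cdifferentiable (f \o cinv (chart_at x)) (cmap (chart_at x) x).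

Lemma smooth_on_mdifferentiable U f x : smooth_on U f -> U x ->
  mdifferentiable f x.
Proof.
move=> sf Ux; apply: csmooth_cdifferentiable (sf _) _.
by exists x => //; split=> //; exact: chart_atP.
Qed.

Lemma smooth_on_sub U U' f : U `<=` U' -> smooth_on U' f -> smooth_on U f.
Proof.
move=> UU' sf c; apply: csmooth_sub (sf c).
by apply: image_subset => x [/UU'].
Qed.

Lemma smooth_on_eq U f g : open U -> (forall z, U z -> f z = g z) ->
  smooth_on U f -> smooth_on U g.
Proof.
move=> oU fg sf c; apply: csmooth_eq (sf c); first exact: open_cmap_image.
by move=> _ [x [Ux cx] <-] /=; rewrite cmapK // fg.
Qed.

Lemma smooth_on_cst U (a : C) : smooth_on U (fun=> a).
Proof. by move=> c; exact: csmooth_cst. Qed.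

Lemma smooth_onD U f g : open U -> smooth_on U f -> smooth_on U g ->
  smooth_on U (fun z => f z + g z).
Proof. by move=> oU sf sg c; apply: csmoothD => //; exact: open_cmap_image. Qed.

Lemma smooth_onM U f g : open U -> smooth_on U f -> smooth_on U g ->
  smooth_on U (fun z => f z * g z).
Proof. by move=> oU sf sg c; apply: csmoothM => //; exact: open_cmap_image. Qed.

Lemma smooth_onV U f : open U -> (forall z, U z -> f z != 0) ->
  smooth_on U f -> smooth_on U (fun z => (f z)^-1).
Proof.
move=> oU f0 sf c; apply: (@csmoothV _ _ _ (f \o cinv c)) => //.
  exact: open_cmap_image.
by move=> _ [x [Ux cx] <-] /=; rewrite cmapK // f0.
Qed.

Lemma holo_on_smooth U f : holo_on U f -> smooth_on U f.
Proof. by move=> hf c; have [] := hf c. Qed.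

Lemma holo_on_sub U U' f : U `<=` U' -> holo_on U' f -> holo_on U f.
Proof.
move=> UU' sf c; apply: cholo_sub (sf c).
by apply: image_subset => x [/UU'].
Qed.

Lemma holo_onM U f g : open U -> holo_on U f -> holo_on U g ->
  holo_on U (fun z => f z * g z).
Proof. by move=> oU sf sg c; apply: choloM => //; exact: open_cmap_image. Qed.

Lemma near_eq_mdiff f g x : (\forall y \near x, f y = g y) ->
  mdifferentiable f x ->
  mdifferentiable g x /\ forall v, mdiff g x v = mdiff f x v.
Proof.
move=> fg df; apply: near_eq_cdiff df.
exact: cinv_near (chart_atP x) fg.
Qed.

Lemma mdifferentiable_cst (a : C) (x : X) : mdifferentiable (fun=> a) x.
Proof. exact: cdifferentiable_cst. Qed.

Lemma mdiff_cst (a : C) (x : X) v : mdiff (fun=> a) x v = 0.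
Proof. exact: cdiff_cst. Qed.

Lemma mdiff_lin f (x : X) (a : R) (v w : cspace R (cdim (chart_at x))) :
  mdiff f x (a *: v + w) = a%:C%C * mdiff f x v + mdiff f x w.
Proof. exact: cdiff_lin. Qed.

Lemma mdiffD f g x : mdifferentiable f x -> mdifferentiable g x ->
  mdifferentiable (fun y => f y + g y) x /\
  forall v, mdiff (fun y => f y + g y) x v = mdiff f x v + mdiff g x v.
Proof. exact: cdiffD. Qed.

Lemma mdiffM f g x : mdifferentiable f x -> mdifferentiable g x ->
  mdifferentiable (fun y => f y * g y) x /\
  forall v, mdiff (fun y => f y * g y) x v = mdiff f x v * g x + f x * mdiff g x v.
Proof.
move=> df dg; have [dm e] := cdiffM df dg; split=> // v.
by apply: etrans (e v) _ => /=; rewrite cmapK //; exact: chart_atP.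
Qed.

Lemma mdiff_conj f x : mdifferentiable f x ->
  mdifferentiable (fun y => (f y)^*) x /\
  forall v, mdiff (fun y => (f y)^*) x v = (mdiff f x v)^*.
Proof. exact: cdiff_conj. Qed.

Lemma holo_on_mdiff U f x v : holo_on U f -> U x ->
  mdiff f x (imul v) = 'i * mdiff f x v.
Proof.
move=> hf Ux; have [_] := hf (chart_at x); apply.
by exists x => //; split=> //; exact: chart_atP.
Qed.

Section Coordinates.
Variables (c : chart X) (x : X).
Hypothesis cx : cdom c x.

Lemma transition_image d : cdom d x -> (cmap c @` (cdom c `&` cdom d)) (cmap c x).
Proof. by move=> dx; exists x. Qed.

Lemma coord_field_imul (v : cspace R (cdim c)) :
  coord_field (imul v) x = imul (coord_field v x).
Proof.
have hT := @holo_transition _ X c (chart_at x).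
by have := cholo_map_imul hT v (transition_image (chart_atP x)).
Qed.

(** The left-hand side reads the chart around [x], the right-hand side the fixed chart [c]. As
    [coord_field] is defined by the differential of the transition map, this is the chain rule; it
    makes derivatives along coordinate fields smooth in [x]. *)
Lemma mdiff_coord_field f (v : cspace R (cdim c)) : mdifferentiable f x ->
  mdiff f x (coord_field v x) = cdiff (f \o cinv c) (cmap c x) v.
Proof.
move=> df; pose d := chart_at x; have dx : cdom d x := chart_atP x.
pose T := cmap d \o cinv c.
have Tz : T (cmap c x) = cmap d x by rewrite /T /= cmapK.
have dT := cholo_map_differentiable (@holo_transition _ X c d) (transition_image dx).
have df' : cdifferentiable (f \o cinv d) (T (cmap c x)) by rewrite Tz.
have [dfT eT] := cdiff_comp dT df'.
have near_fT : \forall z \near cmap c x, ((f \o cinv d) \o T) z = (f \o cinv c) z.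
  apply: filterS (cinv_near cx (cdom_near dx)) => z dz.
  by rewrite /T /= cmapK.
rewrite (near_eq_cdiff near_fT dfT).2 eT /mdiff.
exact: (congr1 (fun y => cdiff (f \o cinv d) y ('d T (cmap c x) v)) (esym Tz)).
Qed.

End Coordinates.

(** [smooth_on] tests every chart; any other chart is reached from [c] by a holomorphic transition
    map. *)
Lemma smooth_on_chart c U f : open U -> U `<=` cdom c ->
  csmooth (cmap c @` U) (f \o cinv c) -> smooth_on U f.
Proof.
move=> oU Uc sf d; have oW := open_cmap_image d oU.
pose T := cmap c \o @cinv _ X d.
have holT : cholo_map (cmap d @` (U `&` cdom d)) T.
  move=> j; apply: cholo_sub (@holo_transition _ X d c j).
  by apply: image_subset => x [/Uc].
have : csmooth (cmap d @` (U `&` cdom d)) ((f \o cinv c) \o T).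
  apply: csmooth_comp holT _ _ oW _ sf.
  by move=> _ [x [Ux dx] <-]; exists x => //; rewrite /T /= cmapK.
apply: csmooth_eq => // _ [x [Ux dx] <-].
by rewrite /T /= !cmapK //; exact: Uc.
Qed.

Lemma smooth_on_mdiff c U f (v : cspace R (cdim c)) : open U ->
  smooth_on U f ->
  smooth_on (U `&` cdom c) (fun x => mdiff f x (coord_field v x)).
Proof.
move=> oU sf; have oW := open_cmap_image c oU.
apply: (@smooth_on_chart c); first exact: openI oU (open_cdom c).
  by move=> x [].
apply: csmooth_eq (csmooth_cdiff v (sf c)) => // _ [x [Ux cx] <-].
rewrite /= cmapK // mdiff_coord_field //.
exact: smooth_on_mdifferentiable sf Ux.
Qed.

Section Selfmap.
Variable F : X -> X.
Hypothesis holF : holo_selfmap F.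

Lemma holo_selfmap_near x (P : X -> Prop) :
  (\forall y \near F x, P y) -> \forall y \near x, P (F y).
Proof. by have [cF _] := holF; exact: (cF x). Qed.

Lemma holo_on_comp U f : open U -> holo_on U f -> holo_on (F @^-1` U) (f \o F).
Proof.
have [cF hF] := holF.
move=> oU hf c; apply: cholo_local => _ [x [Ux cx] <-].
(* [F] need not send [cdom c] into one chart, so the claim is checked near each point, on the part
   of [cdom c] sent into the chart around [F x]. *)
pose d := chart_at (F x).
pose W := F @^-1` (U `&` cdom d).
have oW : open W.
  by apply: open_comp => [y _|]; [exact: cF|exact: openI oU (open_cdom d)].
exists (cmap c @` (W `&` cdom c)).
  by exists x => //; split=> //; split=> //; exact: chart_atP.
have oWc := open_cmap_image c oW.
pose T := cmap d \o F \o @cinv _ X c.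
have holT : cholo_map (cmap c @` (W `&` cdom c)) T.
  move=> j; apply: cholo_sub (hF c d j).
  by apply: image_subset => y [[]].
have : cholo (cmap c @` (W `&` cdom c)) ((f \o cinv d) \o T).
  apply: cholo_comp holT _ _ oWc _ (hf d).
  by move=> _ [y [[Uy dy] cy] <-]; exists (F y) => //; rewrite /T /= cmapK.
apply: cholo_eq => // _ [y [[Uy dy] cy] <-].
by rewrite /T /= !cmapK.
Qed.

Lemma selfmap_image x :
  (cmap (chart_at x) @` (cdom (chart_at x) `&` F @^-1` cdom (chart_at (F x))))
    (cmap (chart_at x) x).
Proof. by exists x => //; split; exact: chart_atP. Qed.

Lemma map_diff_imul x v : map_diff F x (imul v) = imul (map_diff F x v).
Proof. by have := cholo_map_imul (holF.2 _ _) v (selfmap_image x). Qed.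

Lemma mdiff_comp f x : mdifferentiable f (F x) ->
  mdifferentiable (f \o F) x /\
  forall v, mdiff (f \o F) x v = mdiff f (F x) (map_diff F x v).
Proof.
move=> df; pose c := chart_at x; pose d := chart_at (F x).
have cx : cdom c x := chart_atP x; have dx : cdom d (F x) := chart_atP (F x).
pose T := cmap d \o F \o @cinv _ X c.
have Tz : T (cmap c x) = cmap d (F x) by rewrite /T /= cmapK.
have dT := cholo_map_differentiable (holF.2 c d) (selfmap_image x).
have df' : cdifferentiable (f \o cinv d) (T (cmap c x)) by rewrite Tz.
have [dfT eT] := cdiff_comp dT df'.
have near_fT : \forall z \near cmap c x,
    ((f \o cinv d) \o T) z = (f \o F \o cinv c) z.
  have := cinv_near cx (holo_selfmap_near (cdom_near dx)).
  by apply: filterS => z dz; rewrite /T /= cmapK.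
have [dFf e] := near_eq_cdiff near_fT dfT.
split=> [|v]; first exact: dFf.
apply: etrans (e v) _; rewrite eT.
exact: (congr1 (fun y => cdiff (f \o cinv d) y ('d T (cmap c x) v)) Tz).
Qed.

End Selfmap.

(** The (1,0)-part d'f of the differential, complementary to [mdbar]. *)
Definition mdel f (x : X) (v : tangent x) : C :=
  2^-1 * (mdiff f x v - 'i * mdiff f x (imul v)).

End ManifoldCalculus.
Arguments mdel {R X} f x v.

(** * Field identities behind the change of frame and the product rule for metrics *)

Section Algebra.
Variable K : numClosedFieldType.
Implicit Types (g H u dg dgc : K).

Lemma half_sum (a : K) : 2^-1 * (a + a) = a.
Proof. by rewrite -mulr2n -[a *+ 2]mulr_natl mulKf // pnatr_eq0. Qed.

(** [gc] and [dgc] stand for the conjugates of g and dg, [dHi] for dH(iv). By the Cauchy-Riemann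
    equations dg(iv) is [i * dg], and its conjugate is [- i * dgc]. *)
Lemma frame_change_alg (i g gc H u du dg dgc dH dHi : K) : i * i = -1 ->
  g != 0 -> gc != 0 -> H != 0 ->
  du * g + u * dg + u * g * (H^-1 * (2^-1 * (dH - i * dHi))) =
  g * (du + u * ((g * gc * H)^-1 * (2^-1 *
    (((dg * gc + g * dgc) * H + g * gc * dH) -
     i * ((i * dg * gc + g * (- i * dgc)) * H + g * gc * dHi))))).
Proof.
move=> ii g0 gc0 H0.
(* Isolating [i * i] lets -1 be substituted; then the two [dg] terms add up and the two [dgc] terms
   cancel. *)
have -> : i * ((i * dg * gc + g * (- i * dgc)) * H + g * gc * dHi) =
  (i * i) * (dg * gc - g * dgc) * H + g * gc * (i * dHi) by ring.
by rewrite ii; field; rewrite g0 gc0 H0.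
Qed.

(** Here [b] and [db] are already conjugated. The [dHi] terms cancel, which says that d'H/H and
    d''H/H add up to dH/H. *)
Lemma metric_alg (H a b da db dH dHi i : K) : H != 0 ->
  (da * b + a * db) * H + a * b * dH =
  (da + a * (H^-1 * (2^-1 * (dH - i * dHi)))) * b * H +
  a * (db + b * (H^-1 * (2^-1 * (dH + i * dHi)))) * H.
Proof. by move=> H0; field; rewrite H0. Qed.

End Algebra.

(** * Linear algebra of lines, pure tensors and hermitian forms *)

Section Lines.
Variables (R : realType).
Local Notation C := R[i].

Lemma line_coordK (A : vectType C) (e w : A) : \dim {:A} = 1%N -> e != 0 ->
  line_coord e w *: e = w.
Proof.
move=> dimA e0.
have b : basis_of {:A} [tuple e].
  by rewrite basisEfree seq1_free e0 subvf dimA.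
by have := coord_basis b (memvf w); rewrite big_ord1 => {2}->.
Qed.

Lemma line_coordZ (A : vectType C) (e : A) a : e != 0 -> line_coord e (a *: e) = a.
Proof.
move=> e0; have f1 : free [tuple e] by rewrite seq1_free.
have := coord_free ord0 ord0 f1.
by rewrite /line_coord linearZ /= => ->; rewrite mulr1.
Qed.

Lemma line_coordD (A : vectType C) (e u w : A) :
  line_coord e (u + w) = line_coord e u + line_coord e w.
Proof. exact: linearD. Qed.

Lemma line_coord_scale (A : vectType C) (e u : A) a :
  line_coord e (a *: u) = a * line_coord e u.
Proof. exact: linearZ. Qed.

Lemma pure_neq0 (A B : vectType C) (a : A) (b : B) : a != 0 -> b != 0 ->
  pure a b != 0.
Proof.
have nz (D : vectType C) (d : D) : d != 0 -> exists i, coord (vbasis {:D}) i d != 0.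
  move=> d0; apply/existsP; apply: contraNT d0 => /existsPn d0.
  rewrite (coord_vbasis (memvf d)) big1 // => i _.
  by have /negPn/eqP -> := d0 i; rewrite scale0r.
move=> /nz[i ai] /nz[j bj]; apply/negP => /eqP/matrixP/(_ i j).
by rewrite !mxE => /eqP; rewrite mulf_eq0 (negPf ai) (negPf bj).
Qed.

Lemma pureZl (A B : vectType C) k (a : A) (b : B) : pure (k *: a) b = k *: pure a b.
Proof. by apply/matrixP => i j; rewrite !mxE linearZ /= mulrA. Qed.

Lemma pureZr (A B : vectType C) k (a : A) (b : B) : pure a (k *: b) = k *: pure a b.
Proof. by apply/matrixP => i j; rewrite !mxE linearZ /= mulrCA. Qed.

(** The algebraic part of [is_metric] in a single fibre: what evaluates [tensor_metric] on pure
    tensors and is inherited by pullbacks. *)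
Definition hermitian_at (A : vectType C) (h : A -> A -> C) : Prop :=
  (forall k u u' w, h (k *: u + u') w = k * h u w + h u' w) /\
  (forall u w, h u w = (h w u)^*).

Section Hermitian.
Variables (A : vectType C) (h : A -> A -> C).
Hypothesis hh : hermitian_at h.

Lemma hermitianZl k u w : h (k *: u) w = k * h u w.
Proof.
have [l _] := hh; have h0 : h 0 w = 0.
  by apply: (addrI (h 0 w)); rewrite addr0 -{1}[h 0 w]mul1r -l scaler0 addr0.
by rewrite -[k *: u]addr0 l h0 addr0.
Qed.

Lemma hermitianZr k u w : h u (k *: w) = k^* * h u w.
Proof. by have [_ s] := hh; rewrite s hermitianZl rmorphM [in RHS]s. Qed.

Lemma hermitianDr k u w w' : h u (k *: w + w') = k^* * h u w + h u w'.
Proof. by have [l s] := hh; rewrite s l rmorphD rmorphM [h u w]s [h u w']s. Qed.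

End Hermitian.

End Lines.

(** * The operator d' and logarithmic derivatives *)

Section Mdel.
Variables (R : realType) (X : complex_manifold R).
Local Notation C := R[i].
Implicit Types f g H u : X -> C.

Lemma imul_imul m (v : cspace R m) : imul (imul v) = - v.
Proof. by case: v. Qed.

Lemma imul_lin m (a : R) (v w : cspace R m) :
  imul (a *: v + w) = a *: imul v + imul w.
Proof.
by apply: injective_projections; rewrite /imul //= opprD scalerN.
Qed.

Lemma mulCii : 'i * 'i = -1 :> C.
Proof. by rewrite -expr2 sqrCi. Qed.

Lemma mdiffN f (x : X) (v : cspace R (cdim (chart_at x))) :
  mdiff f x (- v) = - mdiff f x v.
Proof. exact: cdiffN. Qed.

Lemma mdel_lin f (x : X) (a : R) (v w : cspace R (cdim (chart_at x))) :
  mdel f x (a *: v + w) = a%:C%C * mdel f x v + mdel f x w.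
Proof.
rewrite /mdel imul_lin !mdiff_lin.
by move: (mdiff _ _ _) (mdiff _ _ _) (mdiff _ _ _) (mdiff _ _ _) => p q r s; ring.
Qed.

Lemma mdel_imul f (x : X) v : mdel f x (imul v) = 'i * mdel f x v.
Proof.
rewrite /mdel imul_imul mdiffN mulrN opprK mulrCA mulrBr; congr (_ * _).
by rewrite mulrA mulCii mulN1r opprK addrC.
Qed.

Lemma near_eq_mdel f g x v : (\forall y \near x, f y = g y) ->
  mdifferentiable f x -> mdel g x v = mdel f x v.
Proof. by move=> fg df; rewrite /mdel !(near_eq_mdiff fg df).2. Qed.

Lemma mdelM f g x v : mdifferentiable f x -> mdifferentiable g x ->
  mdel (fun y => f y * g y) x v = mdel f x v * g x + f x * mdel g x v.
Proof.
move=> df dg; rewrite /mdel !(mdiffM df dg).2.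
by move: (mdiff _ _ _) (mdiff _ _ _) (mdiff _ _ _) (mdiff _ _ _) => p q r s; ring.
Qed.

(** A function that is real near x has a real differential, so conjugation only changes the sign of
    i: it exchanges d'f and d''f. *)
Lemma mdel_conj f x v : mdifferentiable f x ->
  (\forall y \near x, f y = (f y)^*) ->
  (mdel f x v)^* = 2^-1 * (mdiff f x v + 'i * mdiff f x (imul v)).
Proof.
move=> df fc; have [_ e] := mdiff_conj df.
have real w : (mdiff f x w)^* = mdiff f x w.
  by rewrite -e (near_eq_mdiff fc df).2.
rewrite /mdel rmorphM rmorphB rmorphM /= !real conjCi mulNr opprK.
by rewrite fmorphV rmorph_nat.
Qed.

(* The connection form d'H/H of the Chern connection in a holomorphic frame of
   square length H. *)
Definition dlog H (x : X) (v : tangent x) : C := (H x)^-1 * mdel H x v.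
Arguments dlog H x v : clear implicits.

Lemma dlogM f g x v : mdifferentiable f x -> mdifferentiable g x ->
  f x != 0 -> g x != 0 ->
  dlog (fun y => f y * g y) x v = dlog f x v + dlog g x v.
Proof.
move=> df dg f0 g0; rewrite /dlog mdelM //.
by move: (mdel _ _ _) (mdel _ _ _) => p q; field; rewrite f0 g0.
Qed.

(* The terms in g cancel because d'(g^* ) = 0 and d'g = dg for holomorphic g. *)
Lemma dlog_frame_change U g H H' u u' x v : holo_on U g -> U x ->
  (\forall y \near x, u y = u' y * g y) ->
  (\forall y \near x, H' y = g y * (g y)^* * H y) ->
  mdifferentiable u' x -> mdifferentiable H x -> g x != 0 -> H x != 0 ->
  mdiff u x v + u x * dlog H x v = g x * (mdiff u' x v + u' x * dlog H' x v).
Proof.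
move=> hg Ux uE HE du dH g0 H0.
have dg : mdifferentiable g x.
  exact: smooth_on_mdifferentiable (holo_on_smooth hg) Ux.
have [dgc egc] := mdiff_conj dg.
have [dug eug] := mdiffM du dg.
have [dgg egg] := mdiffM dg dgc.
have [dH' eH'] := mdiffM dgg dH.
have uE' : \forall y \near x, u' y * g y = u y by apply: filterS uE => y ->.
have HE' : \forall y \near x, g y * (g y)^* * H y = H' y.
  by apply: filterS HE => y ->.
rewrite (near_eq_mdiff uE' dug).2 eug (nbhs_singleton uE) /dlog.
rewrite (near_eq_mdel _ HE' dH') (nbhs_singleton HE) /mdel !eH' !egg !egc.
rewrite (holo_on_mdiff _ hg Ux) rmorphM /= conjCi.
apply: frame_change_alg => //; first exact: mulCii.
by rewrite conjC_eq0.
Qed.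

End Mdel.
Arguments dlog {R X} H x v.

(** * The Chern connection *)

Section Chern.
Variables (R : realType) (X : complex_manifold R).
Local Notation C := R[i].

Definition frame_coord (L : bundle X) (s : section L) (x y : X) : C :=
  line_coord (frame L x y) (s y).

Definition sqnorm (L : bundle X) (h : metric L) (x y : X) : C :=
  h y (frame L x y) (frame L x y).

(** The frame used at [x] is the one attached to [x], so the formula is global, but its frame
    changes from point to point; [chern_frame] gives the same value in any other frame defined at
    the point. *)
Definition chern (L : bundle X) (h : metric L) : connection L := fun s x v =>
  (mdiff (frame_coord s x) x v + frame_coord s x x * dlog (sqnorm h x) x v) *:
    frame L x x.
Arguments chern {L} h s x v.

Section LineBundle.
Variables (W : set X) (L : bundle X).
Hypothesis lL : is_line_bundle W L.
Implicit Types (U : set X) (s t : section L).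

Lemma fdom_near x y : fdom L x y -> \forall z \near y, fdom L x z.
Proof. by move=> xy; apply: open_nbhs_nbhs; split=> //; exact: fdom_open lL _. Qed.

Lemma frame_coordK s x y : fdom L x y -> frame_coord s x y *: frame L x y = s y.
Proof.
move=> xy.
exact: line_coordK _ (fibre_dim1 lL (fdom_sub lL xy)) (frame_neq0 lL xy).
Qed.

Lemma frame_holo x : holo_section (fdom L x) (frame L x).
Proof.
move=> y; have [g [hg gE]] := frame_transition lL y x.
by exists g; rewrite setIC.
Qed.

Lemma holo_section_smooth U s : holo_section U s -> smooth_section U s.
Proof.
move=> hs y; have [f [hf fE]] := hs y.
by exists f; split=> //; exact: holo_on_smooth.
Qed.

Lemma frame_smooth x : smooth_section (fdom L x) (frame L x).
Proof. exact: holo_section_smooth (frame_holo x). Qed.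

Lemma smooth_section_sub U U' s : U `<=` U' -> smooth_section U' s ->
  smooth_section U s.
Proof.
move=> UU' ss y; have [f [sf fE]] := ss y.
have sub : U `&` fdom L y `<=` U' `&` fdom L y by move=> z [/UU'].
by exists f; split=> [|z /sub /fE] //; exact: smooth_on_sub sf.
Qed.

Lemma smooth_section_eq U s t : (forall z, U z -> s z = t z) ->
  smooth_section U s -> smooth_section U t.
Proof.
move=> st ss y; have [f [sf fE]] := ss y.
by exists f; split=> // z Uz; rewrite -st ?fE //; case: Uz.
Qed.

Lemma frame_coord_smooth U s x : open U -> smooth_section U s ->
  smooth_on (U `&` fdom L x) (frame_coord s x).
Proof.
move=> oU ss; have [f [sf fE]] := ss x.
apply: smooth_on_eq sf; first exact: openI oU (fdom_open lL _).
move=> z Uz; rewrite /frame_coord fE // line_coordZ //.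
by apply: (frame_neq0 lL); case: Uz.
Qed.

Lemma section_differentiable x y s : smooth_section_near W x s -> fdom L y x ->
  mdifferentiable (frame_coord s y) x.
Proof.
move=> [U [oU Ux UW ss]] yx.
exact: smooth_on_mdifferentiable (frame_coord_smooth y oU ss) _.
Qed.

Lemma frame_smooth_near x y : fdom L y x -> smooth_section_near W x (frame L y).
Proof.
move=> yx; exists (fdom L y); split=> //; first exact: fdom_open lL _.
  by move=> z /(fdom_sub lL).
exact: frame_smooth.
Qed.

Section Metric.
Variable h : metric L.
Arguments h : clear implicits.
Hypothesis mh : is_metric W h.

Lemma metric_hermitian x : W x -> hermitian_at (h x).
Proof.
have [hl hs _ _] := mh.
by move=> Wx; split=> [k u u' w|u w]; [exact: hl|exact: hs].
Qed.

Lemma sqnorm_smooth x : smooth_on (fdom L x) (sqnorm h x).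
Proof.
have [_ _ _ hsm] := mh; apply: hsm; try exact: frame_smooth.
  exact: fdom_open lL _.
by move=> z /(fdom_sub lL).
Qed.

Lemma sqnorm_neq0 x y : fdom L x y -> sqnorm h x y != 0.
Proof.
have [_ _ h0 _] := mh => xy.
by apply/lt0r_neq0/h0; [exact: (fdom_sub lL xy)|exact: (frame_neq0 lL xy)].
Qed.

Lemma sqnorm_differentiable x y : fdom L x y -> mdifferentiable (sqnorm h x) y.
Proof. exact: smooth_on_mdifferentiable (sqnorm_smooth x). Qed.

Lemma sqnormZ x y a b : fdom L x y ->
  h y (a *: frame L x y) (b *: frame L x y) = a * b^* * sqnorm h x y.
Proof.
move=> xy; have hy := metric_hermitian (fdom_sub lL xy).
by rewrite (hermitianZl hy) (hermitianZr hy) mulrA.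
Qed.

Lemma sqnorm_real x y : fdom L x y -> sqnorm h x y = (sqnorm h x y)^*.
Proof. by move=> /(fdom_sub lL) Wy; exact: (metric_hermitian Wy).2. Qed.

(** The transition function from the frame around [z] to the frame around [x] is holomorphic, so
    [dlog_frame_change] applies to it. With [x] fixed and [z] moving, the formula shows that the
    covariant derivative is smooth. *)
Lemma chern_frame x z v s : fdom L x z -> smooth_section_near W z s ->
  chern h s z v = (mdiff (frame_coord s x) z v +
    frame_coord s x z * dlog (sqnorm h x) z v) *: frame L x z.
Proof.
move=> xz ss; have Wz := fdom_sub lL xz; have zz := fdom_self lL Wz.
have [g [hg gE]] := frame_transition lL z x.
have gz : frame L x z = g z *: frame L z z by exact: gE.
have near2 : \forall y \near z, fdom L z y /\ fdom L x y.
  by apply: filterS2 (fdom_near zz) (fdom_near xz).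
have g0 : g z != 0.
  apply: contraTneq (frame_neq0 lL xz) => g0.
  by rewrite gz g0 scale0r eqxx.
rewrite /chern gz [RHS]scalerA; apply: (congr1 (fun k => k *: frame L z z)).
rewrite [RHS]mulrC; apply: (dlog_frame_change v hg) => //.
- apply: filterS near2 => y [zy xy]; rewrite {1}/frame_coord.
  by rewrite -(frame_coordK s xy) gE // scalerA line_coordZ // (frame_neq0 lL zy).
- by apply: filterS near2 => y [zy xy]; rewrite {1}/sqnorm gE // sqnormZ.
- exact: section_differentiable ss xz.
- exact: sqnorm_differentiable.
- exact: sqnorm_neq0.
Qed.

Lemma chern_local x v s t : W x -> smooth_section_near W x s ->
  (\forall y \near x, s y = t y) -> chern h s x v = chern h t x v.
Proof.
move=> Wx ss st; have xx := fdom_self lL Wx.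
have st' : \forall y \near x, frame_coord s x y = frame_coord t x y.
  by apply: filterS st => y e; rewrite /frame_coord e.
have [_ e] := near_eq_mdiff st' (section_differentiable ss xx).
by rewrite /chern e (nbhs_singleton st').
Qed.

Lemma chern_is_connection : is_connection W (chern h).
Proof.
split=> [x v s t Wx ss ts|x v s t Wx ss ts|x v s f U Wx ss oU Ux sf|x a v w s Wx ss|
    U c v s oU UW ss].
- exact: chern_local.
- have xx := fdom_self lL Wx; rewrite /chern.
  have -> : frame_coord (fun y => s y + t y) x =
            fun y => frame_coord s x y + frame_coord t x y.
    by apply/funext => y; exact: line_coordD.
  have [_ e] := mdiffD (section_differentiable ss xx)
    (section_differentiable ts xx).
  by rewrite e -scalerDl mulrDl addrACA.
- have xx := fdom_self lL Wx; rewrite /chern.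
  have -> : frame_coord (fun y => f y *: s y) x =
            fun y => f y * frame_coord s x y.
    by apply/funext => y; exact: line_coord_scale.
  have [_ e] := mdiffM (smooth_on_mdifferentiable sf Ux)
    (section_differentiable ss xx).
  rewrite e -(frame_coordK s xx) !scalerA -scalerDl.
  apply: (congr1 (fun k => k *: frame L x x)).
  by rewrite mulrDr mulrA addrA.
- rewrite /chern /dlog mdiff_lin mdel_lin scalerA -scalerDl.
  apply: (congr1 (fun k => k *: frame L x x)).
  by move: (mdiff _ _ _) (mdiff _ _ _) (mdel _ _ _) (mdel _ _ _) => p q r u; ring.
- move=> y; pose H := sqnorm h y.
  pose df (w : cspace R (cdim c)) z := mdiff (frame_coord s y) z (coord_field w z).
  pose dH (w : cspace R (cdim c)) z := mdiff H z (coord_field w z).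
  have oy := fdom_open lL y.
  pose A := U `&` cdom c `&` fdom L y.
  have oA : open A by exact: openI (openI oU (open_cdom c)) oy.
  have AUy : A `<=` U `&` fdom L y by move=> z [[]].
  have su := frame_coord_smooth y oU ss.
  (* The coefficient given by [chern_frame] in the fixed frame around [y]. By [coord_field_imul], i
     times a coordinate field is again a coordinate field, so d'H is built from derivatives of H
     along two such fields. *)
  exists (fun z => df v z + frame_coord s y z * ((H z)^-1 *
    (2^-1 * (dH v z + - 'i * dH (imul v) z)))); split.
    have sdf w : smooth_on A (df w).
      have := smooth_on_mdiff w (openI oU oy) su; apply: smooth_on_sub.
      by move=> z [[]].
    have sdH w : smooth_on A (dH w).
      have := smooth_on_mdiff w oy (sqnorm_smooth y); apply: smooth_on_sub.
      by move=> z [[]].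
    have sH : smooth_on A H.
      by apply: smooth_on_sub (sqnorm_smooth y) => z [].
    have sV : smooth_on A (fun z => (H z)^-1).
      by apply: smooth_onV => // z [_ yz]; exact: sqnorm_neq0.
    have su' : smooth_on A (frame_coord s y) by exact: smooth_on_sub su.
    have shalf : smooth_on A (fun=> 2^-1 : C) := @smooth_on_cst _ _ _ _.
    have sNi : smooth_on A (fun=> - 'i : C) := @smooth_on_cst _ _ _ _.
    have sdel := smooth_onM oA shalf (smooth_onD oA (sdH v)
      (smooth_onM oA sNi (sdH (imul v)))).
    exact: (smooth_onD oA (sdf v) (smooth_onM oA su' (smooth_onM oA sV sdel))).
  move=> z [[Uz cz] yz].
  have sz : smooth_section_near W z s by exists U.
  rewrite (chern_frame _ yz sz) /dlog /mdel -coord_field_imul //.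
  by rewrite /df /dH mulNr.
Qed.

Lemma chern_preserves : preserves_metric W h (chern h).
Proof.
move=> x v s t Wx ss ts; have xx := fdom_self lL Wx.
pose H := sqnorm h x; pose a := frame_coord s x; pose b := frame_coord t x.
have da : mdifferentiable a x := section_differentiable ss xx.
have db : mdifferentiable b x := section_differentiable ts xx.
have dH : mdifferentiable H x := sqnorm_differentiable xx.
have [dbc ebc] := mdiff_conj db.
have [dab eab] := mdiffM da dbc.
have [dabH eabH] := mdiffM dab dH.
have hE : \forall y \near x, a y * (b y)^* * H y = h y (s y) (t y).
  apply: filterS (fdom_near xx) => y xy.
  by rewrite -sqnormZ // !frame_coordK.
have Hr : \forall y \near x, H y = (H y)^*.
  by apply: filterS (fdom_near xx) => y xy; exact: sqnorm_real.
rewrite (near_eq_mdiff hE dabH).2 eabH eab ebc.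
rewrite -(frame_coordK t xx) -(frame_coordK s xx) /chern !sqnormZ //.
(* H is real, so the conjugate of d'H/H is d''H/H. *)
have dlogc : (dlog H x v)^* =
    (H x)^-1 * (2^-1 * (mdiff H x v + 'i * mdiff H x (imul v))).
  rewrite -(mdel_conj v dH Hr) /dlog; move: (mdel H x v) => q.
  have Hx : (H x)^* = H x by exact: esym (nbhs_singleton Hr).
  by rewrite rmorphM fmorphV /= Hx.
have conjDM (p q r : C) : (p + q * r)^* = p^* + q^* * r^*.
  by rewrite rmorphD rmorphM.
rewrite -/a -/b -/H conjDM dlogc /dlog /mdel.
by apply: metric_alg; exact: sqnorm_neq0.
Qed.

(** The form d'H/H is of type (1,0), by [mdel_imul], so it disappears from the (0,1)-part; what
    remains is dbar of the coordinate of the section. *)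
Lemma chern_holo : holo_compatible W (chern h).
Proof.
move=> x v s Wx ss; rewrite /part01 /chern /dbar /dlog mdel_imul.
rewrite scalerA -scalerDl scalerA; apply: (congr1 (fun k => k *: frame L x x)).
rewrite /mdbar; apply: (congr1 (fun k => 2^-1 * k)).
have -> : 'i * (mdiff (frame_coord s x) x (imul v) + frame_coord s x x *
    ((sqnorm h x x)^-1 * ('i * mdel (sqnorm h x) x v))) =
  'i * mdiff (frame_coord s x) x (imul v) + ('i * 'i) * (frame_coord s x x *
    ((sqnorm h x x)^-1 * mdel (sqnorm h x) x v)).
  by move: (mdiff _ _ _) (mdel _ _ _) (_^-1) => p q r; ring.
by rewrite mulCii mulN1r addrACA subrr addr0.
Qed.

(** The form [th] of [D] in the frame [e] is determined: compatibility with dbar makes it of type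
    (1,0), and preservation of the metric, applied to the square length of [e], then forces it to be
    d'H/H. *)
Lemma chern_unique (D : connection L) : is_connection W D ->
  preserves_metric W h D -> holo_compatible W D ->
  connection_agree W (chern h) D.
Proof.
move=> [Dloc _ Dleib _ _] Dh D01 x v s Wx ss; have xx := fdom_self lL Wx.
pose e := frame L x; pose H := sqnorm h x.
have se : smooth_section_near W x e := frame_smooth_near xx.
pose th w := line_coord (frame L x x) (D e x w).
have thE w : D e x w = th w *: e x.
  exact: esym (line_coordK _ (fibre_dim1 lL Wx) (frame_neq0 lL xx)).
have H0 : H x != 0 := sqnorm_neq0 xx.
have dH : mdifferentiable H x := sqnorm_differentiable xx.
(* dbar kills [e], whose coordinate is the constant 1, so the (0,1)-part of [th] vanishes. *)
have th_imul w : th (imul w) = 'i * th w.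
  have := D01 x w e Wx se; rewrite /part01 /dbar /mdbar.
  have e1 : \forall y \near x, (fun=> 1 : C) y = line_coord (frame L x y) (e y).
    apply: filterS (fdom_near xx) => y xy.
    by rewrite -[e y]scale1r line_coordZ // (frame_neq0 lL xy).
  rewrite !(near_eq_mdiff e1 (mdifferentiable_cst _ _)).2 !mdiff_cst.
  rewrite mulr0 addr0 mulr0 scale0r !thE scalerA -scalerDl => /eqP.
  rewrite !scaler_eq0 (negPf (frame_neq0 lL xx)) invr_eq0 pnatr_eq0 /= orbF.
  move=> /eqP th0; apply: (mulfI (neq0Ci C)); rewrite mulrA mulCii mulN1r.
  by apply/eqP; rewrite -addr_eq0 addrC th0.
have dHE w : mdiff H x w = th w * H x + (th w)^* * H x.
  have := Dh x w e e Wx se se; rewrite thE.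
  have hx := metric_hermitian Wx.
  by rewrite (hermitianZl hx) (hermitianZr hx).
(* From dH = (th + conj th) H, the operator d' keeps [th], which is of type (1,0), and drops its
   conjugate. *)
have thH : th v = dlog H x v.
  rewrite /dlog /mdel !dHE th_imul rmorphM /= conjCi.
  transitivity (2^-1 * (th v * (1 - 'i * 'i) + (th v)^* * (1 + 'i * 'i))).
    by rewrite mulCii subrr mulr0 addr0 opprK mulrDr mulr1 half_sum.
  by move: (th v)^* => q; field; rewrite H0.
(* Near [x] the section is [u] times [e], so locality and the Leibniz rule express [D s] through
   [D e]. *)
have [U [oU Ux UW ssU]] := ss.
pose u := frame_coord s x; pose A := U `&` fdom L x.
have oA : open A by exact: openI oU (fdom_open lL _).
have Ax : A x by [].
have su : smooth_on A u := frame_coord_smooth x oU ssU.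
have su_e : \forall y \near x, s y = u y *: e y.
  by apply: filterS (fdom_near xx) => y xy; rewrite frame_coordK.
have sue : smooth_section_near W x (fun y => u y *: e y).
  exists A; split=> // [y []|]; first by move=> /UW.
  apply: (@smooth_section_eq _ s) => [y [Uy xy]|]; first by rewrite frame_coordK.
  by apply: smooth_section_sub ssU => y [].
rewrite (Dloc x v s _ Wx ss sue su_e) (Dleib x v e u A Wx se oA Ax su) thE.
by rewrite scalerA -scalerDl /chern thH.
Qed.

End Metric.
End LineBundle.
End Chern.
Arguments chern {R X L} h s x v.

(** * Tensor products and pullbacks *)

Section Constructions.
Variables (R : realType) (X : complex_manifold R).
Local Notation C := R[i].
Implicit Types (W U : set X) (L M : bundle X).

(** The formula is asked of all sections, smooth or not, because [chern], [tensor_connection] and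
    [pullback_connection] are all given by explicit formulas; no smoothness has to be carried
    through tensor products and pullbacks. *)
Definition chern_form L (D : connection L) (x : X) (H : X -> C) : Prop :=
  forall (s : section L) v,
    D s x v = (mdiff (frame_coord s x) x v + frame_coord s x x * dlog H x v) *:
      frame L x x.

(* Stated at one point and without asking h to be a metric, in order to pass
   directly to tensor products and pullbacks. *)
Definition chern_at L (h : metric L) (D : connection L) (x : X) : Prop :=
  exists H : X -> C,
  [/\ mdifferentiable H x, H x != 0, \forall y \near x, frame L x y != 0,
      \forall y \near x, forall a, h y (a *: frame L x y) (a *: frame L x y) =
        a * a^* * H y &
      chern_form D x H].

Lemma chern_chern_at W L (h : metric L) x : is_line_bundle W L ->
  is_metric W h -> W x -> chern_at h (chern h) x.
Proof.
move=> lL mh Wx; have xx := fdom_self lL Wx.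
exists (sqnorm h x); split=> //.
- exact: (sqnorm_differentiable lL mh xx).
- exact: (sqnorm_neq0 lL mh xx).
- by apply: filterS (fdom_near lL xx) => y /(frame_neq0 lL).
- by apply: filterS (fdom_near lL xx) => y xy a; rewrite (sqnormZ lL mh).
Qed.

Lemma frame_coord_frame L x y : frame L x y != 0 -> frame_coord (frame L x) x y = 1.
Proof.
by move=> e0; rewrite /frame_coord -[X in line_coord _ X]scale1r line_coordZ.
Qed.

Lemma chern_form_frame L (D : connection L) x H v : chern_form D x H ->
  (\forall y \near x, frame L x y != 0) ->
  D (frame L x) x v = dlog H x v *: frame L x x.
Proof.
move=> cD e0.
have e1 : \forall y \near x, (fun=> 1 : C) y = frame_coord (frame L x) x y.
  by apply: filterS e0 => y /frame_coord_frame.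
rewrite cD (near_eq_mdiff e1 (mdifferentiable_cst _ _)).2 mdiff_cst add0r.
by rewrite -(nbhs_singleton e1) mul1r.
Qed.

Section Tensor.
Variables (L M : bundle X).

Lemma tensor_line_bundle W W' : is_line_bundle W L -> is_line_bundle W' M ->
  is_line_bundle (W `&` W') (tensor_bundle L M).
Proof.
move=> lL lM; split.
- exact: openI (base_open lL) (base_open lM).
- move=> x [Wx W'x]; rewrite dimvf -[LHS]/(\dim {:L x} * \dim {:M x})%N.
  by rewrite (fibre_dim1 lL Wx) (fibre_dim1 lM W'x).
- by move=> x [/(fdom_self lL) ? /(fdom_self lM)].
- by move=> x; exact: openI (fdom_open lL x) (fdom_open lM x).
- by move=> x y [/(fdom_sub lL) ? /(fdom_sub lM)].
- move=> x y [Lxy Mxy].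
  by apply: pure_neq0; [exact: (frame_neq0 lL Lxy)|exact: (frame_neq0 lM Mxy)].
- move=> x y; have [f [hf fE]] := frame_transition lL x y.
  have [g [hg gE]] := frame_transition lM x y.
  have oA : open ((fdom L x `&` fdom M x) `&` (fdom L y `&` fdom M y)).
    by do ![exact: fdom_open lL _|exact: fdom_open lM _|apply: openI].
  exists (fun z => f z * g z); split.
    by apply: (holo_onM oA); [apply: holo_on_sub hf|apply: holo_on_sub hg]
      => z [[? ?] []].
  move=> z [[? ?] [? ?]]; rewrite /= fE // gE //.
  by rewrite pureZl pureZr scalerA.
Qed.

(** [tliftE] wants linear maps, while a metric is antilinear in its second variable. The conjugate
    inside the inner [tlift] makes it linear there, and the outer one undoes this. *)
Lemma tensor_metric_pure (h : metric L) (k : metric M) x a b a' b' :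
  hermitian_at (@h x) -> hermitian_at (@k x) ->
  tensor_metric h k x (pure a b) (pure a' b') = @h x a a' * @k x b b'.
Proof.
move=> hh hk; rewrite /tensor_metric.
have conj_lin (c p q : C) : (c^* * p + q)^* = c * p^* + q^*.
  by rewrite rmorphD rmorphM /= conjCK.
have -> : (fun (a : L x) (b : M x) => (tlift (D := C^o) (fun a' b' =>
      (@h x a a' * @k x b b')^*) (pure a' b'))^*) = fun a b => @h x a a' * @k x b b'.
  apply/funext => p; apply/funext => q; rewrite tliftE.
  - by rewrite conjCK.
  - by move=> w c u u'; rewrite (hermitianDr hh) mulrDl -mulrA conj_lin.
  - by move=> u c w w'; rewrite (hermitianDr hk) mulrDr mulrCA conj_lin.
rewrite tliftE //.
- by move=> w c u u'; rewrite hh.1 mulrDl -mulrA.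
- by move=> u c w w'; rewrite hk.1 mulrDr mulrCA.
Qed.

(** The forms of the two factors add in [tensor_connection], the square lengths multiply in
    [tensor_metric], and [dlogM] matches the two. *)
Lemma tensor_chern_at (h : metric L) (k : metric M) D D' x :
  (\forall y \near x, hermitian_at (@h y)) ->
  (\forall y \near x, hermitian_at (@k y)) ->
  chern_at h D x -> chern_at k D' x ->
  chern_at (tensor_metric h k) (tensor_connection D D') x.
Proof.
move=> hh hk [H [dH H0 e0 he cD]] [H' [dH' H'0 f0 kf cD']].
have [dHH' _] := mdiffM dH dH'.
exists (fun y => H y * H' y); split=> //.
- by rewrite mulf_neq0.
- by apply: filterS2 e0 f0 => y; exact: pure_neq0.
- near=> y => a; have hy : hermitian_at (@h y) by near: y.
  have ky : hermitian_at (@k y) by near: y.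
  have hey : forall a, h y (a *: frame L x y) (a *: frame L x y) = a * a^* * H y.
    by near: y.
  have kfy : forall a, k y (a *: frame M x y) (a *: frame M x y) = a * a^* * H' y.
    by near: y.
  rewrite -!pureZl tensor_metric_pure // hey.
  by rewrite -[frame M x y]scale1r kfy conjC1 !mul1r mulrA.
- move=> s v; rewrite /tensor_connection (chern_form_frame v cD e0).
  rewrite (chern_form_frame v cD' f0) pureZl pureZr -scalerDl scalerA -scalerDl.
  by rewrite -dlogM.
Unshelve. all: by end_near.
Qed.

End Tensor.

Section Pullback.
Variables (F : X -> X) (L : bundle X).
Hypothesis holF : holo_selfmap F.

Lemma pullback_line_bundle W : is_line_bundle W L ->
  is_line_bundle (F @^-1` W) (pullback_bundle F L).
Proof.
have [cF _] := holF.
have oF U : open U -> open (F @^-1` U) by apply: open_comp => y _; exact: cF.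
move=> lL; split.
- exact: oF (base_open lL).
- by move=> x /(fibre_dim1 lL).
- by move=> x /(fdom_self lL).
- by move=> x; apply: oF; exact: fdom_open lL _.
- by move=> x y /(fdom_sub lL).
- by move=> x y xy; exact: (frame_neq0 lL xy).
- move=> x y; have [f [hf fE]] := frame_transition lL (F x) (F y).
  exists (f \o F); split; last by move=> z xyz; exact: fE.
  exact: (holo_on_comp holF (openI (fdom_open lL _) (fdom_open lL _)) hf).
Qed.

Lemma pullback_hermitian (h : metric L) x :
  (\forall y \near F x, hermitian_at (@h y)) ->
  \forall y \near x, hermitian_at (@pullback_metric _ _ F _ h y).
Proof. exact: (holo_selfmap_near holF). Qed.

(** The differential of a holomorphic [F] commutes with [imul], so pulling back preserves the type
    of forms: the pullback of d'H/H is the same expression for [H \o F]. *)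
Lemma pullback_chern_at (h : metric L) D x : chern_at h D (F x) ->
  chern_at (pullback_metric F h) (pullback_connection F D) x.
Proof.
move=> [H [dH H0 e0 he cD]]; have [dHF eHF] := mdiff_comp holF dH.
exists (H \o F); split=> //.
- exact: (holo_selfmap_near holF e0).
- exact: (holo_selfmap_near holF he).
- move=> s v; rewrite /pullback_connection (chern_form_frame _ cD e0).
  rewrite scalerA -scalerDl /dlog /mdel !eHF.
  by rewrite (map_diff_imul holF).
Qed.

End Pullback.

(** [phi] sends the frame of [L] to g times that of [M] with g holomorphic, and unitarity gives H' =
    |g|^2 H: the situation of a change of frame inside one bundle. There are three sets because a
    structure map may live on a smaller intersection than the bundles it relates. *)
Lemma chern_intertwines W W1 W2 L M (hL : metric L) (hM : metric M)
    (DL : connection L) (DM : connection M) (phi : bundle_map L M) :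
  open W -> W `<=` W1 -> W `<=` W2 ->
  is_line_bundle W1 L -> is_line_bundle W2 M ->
  (forall x, W x -> chern_at hL DL x) -> (forall x, W x -> chern_at hM DM x) ->
  holo_iso W phi -> unitary W hL hM phi -> intertwines W DL DM phi.
Proof.
move=> oW W1W W2W lL lM cL cM [phi_bij phi_holo] phi_unit x v s Wx ss.
have [H' [dH' H'0 e'0 he' cD']] := cL x Wx.
have [H [dH H0 e0 he cD]] := cM x Wx.
have xL := fdom_self lL (W1W _ Wx); have xM := fdom_self lM (W2W _ Wx).
pose U := W `&` fdom L x.
have oU : open U by exact: openI oW (fdom_open lL _).
have UW : U `<=` W by move=> z [].
have eU : holo_section U (frame L x).
  move=> y; have [f [hf fE]] := frame_holo lL x y.
  have sub : U `&` fdom L y `<=` fdom L x `&` fdom L y by move=> z [[]].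
  by exists f; split=> [|z /sub /fE] //; exact: holo_on_sub hf.
have [g [hg gE]] := phi_holo U (frame L x) oU UW eU x.
have Ux : (U `&` fdom M x) x by [].
have nearU : \forall y \near x, (U `&` fdom M x) y.
  by apply: open_nbhs_nbhs; split=> //; apply: openI oU (fdom_open lM _).
have HE : \forall y \near x, H' y = g y * (g y)^* * H y.
  near=> y; have Uy : (U `&` fdom M x) y by near: y.
  have hLy : forall a, hL y (a *: frame L x y) (a *: frame L x y) = a * a^* * H' y.
    by near: y.
  have hMy : forall a, hM y (a *: frame M x y) (a *: frame M x y) = a * a^* * H y.
    by near: y.
  rewrite -hMy -gE // phi_unit; last exact: UW Uy.1.
  by rewrite -[frame L x y]scale1r hLy conjC1 !mul1r.
(* Unitarity also keeps g from vanishing: a zero of g at [x] would be a zero of H'. *)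
have g0 : g x != 0.
  apply: contraNneq H'0 => g0.
  by rewrite (nbhs_singleton HE) g0 !mul0r.
have ssL : smooth_section_near W1 x s.
  have [U' [oU' U'x U'W sU']] := ss.
  by exists U'; split=> // z /U'W /W1W.
have uE : \forall y \near x, frame_coord (fun y => phi y (s y)) x y =
    frame_coord s x y * g y.
  apply: filterS nearU => y [[Wy xy] xMy]; rewrite {1}/frame_coord.
  rewrite -(frame_coordK lL s xy) linearZ /= gE // scalerA.
  by rewrite line_coordZ // (frame_neq0 lM xMy).
have phiZ a : phi x (a *: frame L x x) = (a * g x) *: frame M x x.
  by rewrite linearZ /= gE // scalerA.
rewrite cD' phiZ cD.
apply: (congr1 (fun k => k *: frame M x x)).
rewrite mulrC; apply: esym.
apply: (dlog_frame_change v hg Ux uE HE _ dH g0 H0).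
exact: (section_differentiable lL ssL xL).
Unshelve. all: by end_near.
Qed.

End Constructions.

Lemma metric_hermitian_near (R : realType) (X : complex_manifold R) (W : set X)
    (L : bundle X) (h : metric L) x : open W -> is_metric W h -> W x ->
  \forall y \near x, hermitian_at (@h y).
Proof.
move=> oW mh Wx; have : \forall y \near x, W y by exact: open_nbhs_nbhs.
by apply: filterS => y; exact: metric_hermitian.
Qed.

(** * The Chern connections of the bundles of a gerbe *)

Section ChernConnections.
Variables (R : realType) (X : complex_manifold R) (G : groupType).
Variables (aX : action G X) (I : Type) (aI : action G I) (V : I -> set X).
Hypothesis aX_holo : forall g : G, holo_selfmap (aX g).
Hypothesis V_cover : equivariant_open_cover aX aI V.
Variables (gb : equivariant_gerbe aX aI V) (h : hermitian_structure gb).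

Definition chern_connections : connections gb :=
  Connections (fun a b => chern (@hL _ _ _ _ _ _ _ _ h a b))
    (fun a g => chern (@hE _ _ _ _ _ _ _ _ h a g)).

Lemma cover_open a : open (V a).
Proof. by have [] := V_cover. Qed.

Lemma cover_act a g x : V a x -> V (aI g a) (aX g x).
Proof. by have [_ _ <-] := V_cover => ax; exists x. Qed.

Lemma V2_open a b : open (V2 V a b).
Proof. by apply: openI; exact: cover_open. Qed.

Lemma V2_act a b g x : V2 V a b x -> V2 V (aI g a) (aI g b) (aX g x).
Proof. by move=> [ax bx]; split; exact: cover_act. Qed.

Lemma chern_connective : connective_structure chern_connections.
Proof.
have lL a b := gL_line gb a b; have lE a g := gE_line gb a g.
have mL a b := hL_metric h a b; have mE a g := hE_metric h a g.
have atL a b x : V2 V a b x ->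
    chern_at (hL h a b) (nL chern_connections a b) x.
  exact: chern_chern_at (lL a b) (mL a b).
have atE a g x : V a x -> chern_at (hE h a g) (nE chern_connections a g) x.
  exact: chern_chern_at (lE a g) (mE a g).
have hermL a b x : V2 V a b x ->
    \forall y \near x, hermitian_at (@hL _ _ _ _ _ _ _ _ h a b y).
  by move=> Vx; exact: metric_hermitian_near (V2_open a b) (mL a b) Vx.
have hermE a g x : V a x ->
    \forall y \near x, hermitian_at (@hE _ _ _ _ _ _ _ _ h a g y).
  by move=> Vx; exact: metric_hermitian_near (cover_open a) (mE a g) Vx.
split.
- by move=> a b; exact: chern_is_connection (lL a b) _ (mL a b).
- by move=> a g; exact: chern_is_connection (lE a g) _ (mE a g).
- move=> a b c; apply: chern_intertwines (lL a c)
    (tensor_line_bundle (lL a b) (lL b c)) _ _ (gphi3_iso gb a b c)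
    (@gphi3_unitary _ _ _ _ _ _ _ _ h a b c).
  + exact: openI (V2_open a b) (cover_open c).
  + by move=> x [[]].
  + by move=> x [[]].
  + by move=> x [[? ?] ?]; apply: atL.
  + move=> x [[? ?] ?].
    by apply: tensor_chern_at; [apply: hermL|apply: hermL|apply: atL|apply: atL].
- move=> a b g; have hF := aX_holo g^-1%g.
  apply: chern_intertwines (tensor_line_bundle
    (pullback_line_bundle hF (lL _ _)) (lE b g))
    (tensor_line_bundle (lE a g) (lL a b)) _ _ (gphi2_iso gb a b g)
    (@gphi2_unitary _ _ _ _ _ _ _ _ h a b g).
  + exact: V2_open.
  (* The pulled-back bundle lives over the preimage of the intersection with indices g^-1 a and g^-1
     b; equivariance of the covering places V_a ∩ V_b inside it. *)
  + by move=> x abx; split; [exact: V2_act|case: abx].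
  + by move=> x abx; split=> //; case: abx.
  + move=> x abx; have abx' := V2_act g^-1%g abx; have [ax bx] := abx.
    apply: tensor_chern_at; [|exact: hermE| |exact: atE].
      by apply: pullback_hermitian; [exact: hF|exact: hermL].
    by apply: pullback_chern_at; [exact: hF|exact: atL].
  + move=> x abx; have [ax bx] := abx.
    by apply: tensor_chern_at; [exact: hermE|exact: hermL|exact: atE|exact: atL].
- move=> a g k; have hF := aX_holo g^-1%g.
  apply: chern_intertwines (lE a (g * k)%g) (tensor_line_bundle (lE a g)
    (pullback_line_bundle hF (lE _ _))) _ _ (gphi1_iso gb a g k)
    (@gphi1_unitary _ _ _ _ _ _ _ _ h a g k).
  + exact: cover_open.
  + by [].
  + by move=> x ax; split=> //; exact: cover_act.
  + by move=> x ax; exact: atE.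
  + move=> x ax; have ax' := cover_act g^-1%g ax.
    apply: tensor_chern_at; [exact: hermE| |exact: atE|].
      by apply: pullback_hermitian; [exact: hF|exact: hermE].
    by apply: pullback_chern_at; [exact: hF|exact: atE].
Qed.

End ChernConnections.

Theorem theorem8p4 (R : realType) (X : complex_manifold R) (G : groupType)
    (aX : action G X) (aX_holo : forall g : G, holo_selfmap (aX g))
    (I : Type) (aI : action G I) (V : I -> set X)
    (V_cover : equivariant_open_cover aX aI V)
    (gb : equivariant_gerbe aX aI V) (h : hermitian_structure gb) :
  exists D : connections gb,
    compatible_connective_structure h D /\
    forall D' : connections gb,
      compatible_connective_structure h D' -> same_connections D D'.
Proof.
have lL a b := gL_line gb a b; have lE a g := gE_line gb a g.
have mL a b := hL_metric h a b; have mE a g := hE_metric h a g.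
exists (chern_connections h); split.
  split.
  - exact: chern_connective.
  - by move=> a b; exact: chern_preserves (lL a b) _ (mL a b).
  - by move=> a g; exact: chern_preserves (lE a g) _ (mE a g).
  - by move=> a b; exact: chern_holo.
  - by move=> a g; exact: chern_holo.
move=> D' [[cL cE _ _ _] pL pE hL hE]; split=> [a b|a g].
  exact: chern_unique (lL a b) _ (mL a b) _ (cL a b) (pL a b) (hL a b).
exact: chern_unique (lE a g) _ (mE a g) _ (cE a g) (pE a g) (hE a g).
Qed.
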